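(* Let $(X_t)_{t\ge 0}$ be a càdlàg Markov jump process on a Polish space $(\mathcal{X},d)$ with stable and conservative transition kernel $Q$ and semigroup $(P_t)_{t\ge0}$, such that $P_t(x,\cdot)\in\mathscr{P}_d(\mathcal{X})$ for all $t>0$, $x\in\mathcal{X}$, and let $\sigma$ be its Wasserstein curvature with respect to $d$. Assume $\sigma>0$ and that there exist two positive constants $b$ and $V$ such that $$\sup_{t>0} d(X_{t-},X_t)\le b \quad\text{and}\quad \left\|\int_{\mathcal{X}} d(\cdot,y)^2\,Q(\cdot,\mathrm{d}y)\right\|_\infty\le V^2,$$ the first bound being understood $\mathbb{P}_x$-almost surely for every $x\in\mathcal{X}$. Let $\pi\in\mathscr{P}_d(\mathcal{X})$ be the unique stationary distribution of the process and let $\phi\in\mathrm{Lip}_d(\mathcal{X})$. Then for any initial state $x\in\mathcal{X}$, any $t>0$ and any $y>0$, $$\mathbb{P}_x\left(\left|\frac1t\int_0^t\phi(X_s)\,\mathrm{d}s-\pi(\phi)\right|\ge y+M_t^x\right)\le 2\exp\left\{-\frac{V^2 t}{b^2}\, g\!\left(\frac{b\,y\,\sigma}{V^2(1-e^{-\sigma t})\|\phi\|_{\mathrm{Lip}_d}}\right)\right\},$$ where $g(u)=(1+u)\log(1+u)-u$ for $u>0$, $\pi(\phi)=\int_{\mathcal{X}}\phi\,\mathrm{d}\pi$, and $$M_t^x:=\frac{(1-e^{-\sigma t})\|\phi\|_{\mathrm{Lip}_d}}{\sigma t}\int_{\mathcal{X}}d(x,z)\,\pi(\mathrm{d}z)\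 \longrightarrow\ 0\quad\text{as } t\to+\infty.$$
   Context: $\mathcal{X}$ is a Polish space endowed with a metric $d$. $\mathscr{B}(\mathcal{X})$ is the space of bounded measurable functions on $\mathcal{X}$ with the supremum norm $\|\cdot\|_\infty$. $\mathrm{Lip}_d(\mathcal{X})$ is the space of functions $f:\mathcal{X}\to\mathbb{R}$ with $\|f\|_{\mathrm{Lip}_d}:=\sup_{x\ne y}|f(x)-f(y)|/d(x,y)<+\infty$. $\mathscr{P}_d(\mathcal{X})$ is the space of probability measures $\mu$ on $\mathcal{X}$ with $\int_{\mathcal{X}} d(x,y)\,\mu(\mathrm{d}y)<+\infty$ for some (equivalently all) $x\in\mathcal{X}$. Process: on a filtered probability space, $\{(X_t)_{t\ge0},(\mathbb{P}_x)_{x\in\mathcal{X}}\}$ is an $\mathcal{X}$-valued càdlàg Markov jump process ($\mathbb{P}_x$ is its law started at $x$) with generator $\mathcal{L}f(x)=\int_{\mathcal{X}}(f(y)-f(x))\,Q(x,\mathrm{d}y)$ for $f\in\mathscr{B}(\mathcal{X})$. The transition kernel $Q$ is stable and conservative: for all $x\in\mathcal{X}$ and Borel sets $A$, $Q(x,\mathcal{X})<+\infty$ and $\lim_{t\downarrow0}\frac{P_t(x,A)-1_A(x)}{t}=Q(x,A)-Q(x,\mathcal{X})1_A(x)$, where $P_t(x,\mathrm{d}y)=\mathbb{P}_x(X_t\in\mathrm{d}y)$. The semigroup is $P_tf(x)=\mathbb{E}_x[f(X_t)]=\int_{\mathcal{X}} f(y)\,P_t(x,\mathrm{d}y)$. Since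 $P_t(x,\cdot)\in\mathscr{P}_d(\mathcal{X})$ for all $t>0$, $x\in\mathcal{X}$, the function $P_tf$ is well defined for $f\in\mathrm{Lip}_d(\mathcal{X})$. Wasserstein curvature: let $\bar\sigma_d(t):=-\sup\{\log\|P_tf\|_{\mathrm{Lip}_d}:\|f\|_{\mathrm{Lip}_d}=1\}$ for $t\ge 0$, with $\bar\sigma_d(0)=0$. The Wasserstein curvature with respect to $d$ is $\sigma=\sigma_d:=\lim_{t\downarrow0}\bar\sigma_d(t)/t=\inf_{t>0}\bar\sigma_d(t)/t$; equivalently it is the best (maximal) constant $\alpha$ such that $\|P_tf\|_{\mathrm{Lip}_d}\le e^{-\alpha t}\|f\|_{\mathrm{Lip}_d}$ for all $f\in\mathrm{Lip}_d(\mathcal{X})$, $t>0$. It is a known fact that if $\sigma>0$ then the process admits a unique stationary distribution $\pi\in\mathscr{P}_d(\mathcal{X})$. Convention: if $\|\phi\|_{\mathrm{Lip}_d}=0$, the right-hand side of the inequality is read as $0$. *)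

(* Defs.v *)
From HB Require Import structures.
From mathcomp Require Import all_boot all_order all_algebra.
From mathcomp Require Import all_classical all_reals all_analysis measurable_realfun.

Set Implicit Arguments.
Unset Strict Implicit.
Unset Printing Implicit Defensive.

Import Order.TTheory GRing.Theory Num.Theory.
Import numFieldNormedType.Exports.

Local Open Scope classical_set_scope.
Local Open Scope ring_scope.

(* A metric space carrying a sigma-algebra; no compatibility is built in: see
   [borel_sigma_algebra]. *)
#[short(type="measurableMetricType")]
HB.structure Definition MeasurableMetric (K : numDomainType) d :=
  {T of Metric K T & Measurable d T}.

Definition borel_sigma_algebra (R : realType) d
    (E : measurableMetricType R d) : Prop :=
  (@measurable d E) = <<s (@open E) >>.

(* Polish: separable and completely metrizable. The complete metric rho need
   not be the distance d = mdist of E, which is only asked to generate the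
   topology; taking rho = mdist covers complete separable metric spaces. *)
Definition polish (R : realType) (E : metricType R) : Prop :=
  (exists2 S : set E, countable S & dense S) /\
  exists rho : E -> E -> R,
    [/\ forall x y, rho x y = 0 <-> x = y,
        forall x y, rho x y = rho y x,
        forall x y z, rho x z <= rho x y + rho y z,
        forall x : E, nbhs x =
          filter_from [set e : R | 0 < e] (fun e : R => [set y | rho x y < e]) &
        forall u : nat -> E,
          (forall e : R, 0 < e -> exists N, forall m n,
             (N <= m)%N -> (N <= n)%N -> rho (u m) (u n) < e) ->
          exists l : E, u n @[n --> \oo] --> l].

Section lipschitz.
Context (R : realType) (E : metricType R).

(* The element 0 only matters on a one-point space, where there is no pair
   x <> y and ereal_sup set0 = -oo. *)
Definition lip_norm (f : E -> R) : \bar R :=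
  ereal_sup (0%E |` [set z : \bar R | exists x y : E,
    x <> y /\ z = (`|f x - f y| / mdist x y)%:E]).

Definition Lip : set (E -> R) := [set f | (lip_norm f < +oo)%E].

End lipschitz.

Section process.
Context (R : realType) (dE dO : measure_display)
        (E : measurableMetricType R dE) (Omega : measurableType dO).

Definition finite_first_moment (mu : probability E R) : Prop :=
  exists x : E, (\int[mu]_y (mdist x y)%:E < +oo)%E.

Definition cadlag (w : R -> E) : Prop :=
  (forall t, 0 <= t -> w s @[s --> t^'+] --> w t) /\
  (forall t, 0 < t -> exists l : E, w s @[s --> t^'-] --> l).

(* Pure jump path: locally constant to the right of every t >= 0 and to the
   left of every t > 0. By compactness of [0, T] this says that the path is a
   right-continuous step function with finitely many jumps in [0, T]. *)
Definition jump_path (w : R -> E) : Prop :=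
  (forall t, 0 <= t -> \forall s \near t^'+, w s = w t) /\
  (forall t, 0 < t -> exists l : E, \forall s \near t^'-, w s = l).

Definition left_lim (w : R -> E) (t : R) : E := lim (w s @[s --> t^'-]).

(* Only times t >= 0 are relevant; values at negative times are junk. *)
Definition filtration (F : R -> set (set Omega)) : Prop :=
  [/\ forall t, 0 <= t -> sigma_algebra setT (F t),
      forall t, 0 <= t -> F t `<=` measurable &
      forall s t, 0 <= s -> s <= t -> F s `<=` F t].

Variables (P : E -> probability Omega R) (X : R -> {mfun Omega >-> E}).

(* P_t(x, .) is the law of X_t under P_x. *)
Definition transition (t : R) (x : E) : probability E R :=
  distribution (P x) (X t).

Definition semigroup (t : R) (f : E -> R) (x : E) : R :=
  \int[transition t x]_y f y.

Definition markov_process (F : R -> set (set Omega)) : Prop :=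
  [/\ filtration F,
      forall t (A : set E), 0 <= t -> measurable A -> F t (X t @^-1` A),
      forall t (A : set E), 0 <= t -> measurable A ->
        measurable_fun setT (fun x => transition t x A),
      forall x, {ae P x, forall w, X 0 w = x} &
      forall x s t (B : set Omega) (A : set E), 0 <= s -> 0 <= t ->
        F s B -> measurable A ->
        (P x (B `&` (X (s + t) @^-1` A)) =
         \int[P x]_(w in B) transition t (X s w) A)%E].

Definition bounded_measurable : set (E -> R) :=
  [set f : E -> R | measurable_fun setT f /\ exists M, forall x, `|f x| <= M].

Definition generator (Q : R.-ker E ~> E) (f : E -> R) (x : E) : R :=
  \int[Q x]_y (f y - f x).

Definition stable_conservative (Q : R.-ker E ~> E) : Prop :=
  (forall x, (Q x setT < +oo)%E) /\
  (forall x (A : set E), measurable A ->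
     (fine (transition t x A) - \1_A x) / t @[t --> 0^'+] -->
     fine (Q x A) - fine (Q x setT) * \1_A x).

(* The generator is taken pointwise: for unbounded rates Q(x, E) the
   convergence is not uniform in x. *)
Definition has_generator (Q : R.-ker E ~> E) : Prop :=
  forall f, bounded_measurable f -> forall x,
    (semigroup t f x - f x) / t @[t --> 0^'+] --> generator Q f x.

Definition cadlag_markov_jump_process (F : R -> set (set Omega))
    (Q : R.-ker E ~> E) : Prop :=
  [/\ markov_process F,
      forall w, cadlag (fun t => X t w),
      forall w, jump_path (fun t => X t w),
      stable_conservative Q &
      has_generator Q].

(* lne is the extended logarithm: lne 0 = -oo and lne +oo = +oo. *)
Definition sigma_bar (t : R) : \bar R :=
  (- ereal_sup [set lne (lip_norm (semigroup t f)) |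
                 f in [set f : E -> R | lip_norm f = 1%E]])%E.

(* A real number; on a one-point space no f has seminorm 1, sigma_bar = +oo,
   and there is no curvature in this sense. *)
Definition is_wasserstein_curvature (sigma : R) : Prop :=
  (sigma_bar t * (t^-1)%:E)%E @[t --> 0^'+] --> sigma%:E.

Definition stationary (mu : probability E R) : Prop :=
  forall t (A : set E), 0 <= t -> measurable A ->
    (\int[mu]_x transition t x A = mu A)%E.

End process.

Section bound.
Context (R : realType).

Definition g (u : R) : R := (1 + u) * ln (1 + u) - u.

Variables (dE : measure_display) (E : measurableMetricType R dE).

Definition bias (sigma : R) (mu : probability E R) (phi : E -> R)
    (x : E) (t : R) : R :=
  (1 - expR (- (sigma * t))) * fine (lip_norm phi) / (sigma * t) *
  \int[mu]_z mdist x z.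

(* The bound is 0 by convention when phi is constant. *)
Definition deviation_bound (sigma b V : R) (phi : E -> R) (t y : R) : R :=
  if lip_norm phi == 0%E then 0 else
  2 * expR (- (V ^+ 2 * t / b ^+ 2 *
    g (b * y * sigma /
       (V ^+ 2 * (1 - expR (- (sigma * t))) * fine (lip_norm phi))))).

End bound.

(* Main.v *)
Require Import Defs.
From mathcomp Require Import all_boot all_order all_algebra.
From mathcomp Require Import all_classical all_reals all_analysis measurable_realfun.
From mathcomp Require Import ring lra.

Set Implicit Arguments.
Unset Strict Implicit.
Unset Printing Implicit Defensive.

Import Order.TTheory GRing.Theory Num.Theory.
Import numFieldNormedType.Exports.

Local Open Scope classical_set_scope.
Local Open Scope ring_scope.

(** Let L be the Lipschitz seminorm of phi, c = (1 - e^(-sigma t)) L / sigma,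
    m the integral of d(x, .) under pi and psi(u) = e^u - 1 - u. The deviation
    inequality is Chernoff's bound, for phi and for -phi, applied to
      E_x exp(l (int_0^t phi(X_s) ds - t pi(phi)))
        <= exp(t (V^2 / b^2) psi(l c b) + l c m),      l > 0,
    with the optimal l = ln(1 + u) / (c b), u = b y / (V^2 c); the term l c m
    is absorbed by the bias, since c m = t M_t^x ([upper_tail]).

    The exponential moment is bounded by dynamic programming on the time grid
    of step h = t / n. Let U_k(z) be the expectation under P_z of the reward
    h phi(X_h) + ... + h phi(X_{kh}), so that U_{k+1} = P_h(h phi + U_k).
    Contraction of the Lipschitz seminorm by P_h makes h phi + U_k Lipschitz
    with a constant hardly larger than c ([stage_lipc]). For a Lipschitz
    function u with constant L', expanding e^(u(X_h) - u(z)) gives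
      P_h(e^u)(z) <= e^(u(z)) (1 + P_h u(z) - u(z) + P_h(psi(u - u(z)))(z)),
    and since psi(v) / v^2 increases and jumps are bounded by b, the last term
    is of order h int psi(L' d(z, y)) Q(z, dy) <= h (V^2 / b^2) psi(L' b).
    Hence P_h(e^u)(z) <= e^(K h + P_h u(z)) for small h ([one_step_exp]), and
    n such steps yield the factor e^(K t) ([path_weight_laplace]).

    The total rates Q(z, E) need not be bounded, so how small h must be depends
    on z. The induction therefore runs only over the trajectories that stay, at
    the grid times, in the set of states where the one-step estimate holds for
    the current n. A trajectory is a step function, so it takes finitely many
    values on [0, t] and each trajectory is retained for n large
    ([jump_path_near_range]); Fatou's lemma removes the restriction while the
    Riemann sums converge to the time integral ([laplace_dilated]). The same
    argument lifts the boundedness of phi, by truncation ([laplace_lip]).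

    The hypothesis on jumps concerns trajectories, whereas the one-step
    estimate needs that Q(z, .) does not charge {y : d(z, y) > b}; this is
    [kernel_no_big_jump]. *)

(** * The Poisson exponent psi *)

Section poisson_function.
Context (R : realType).

Definition psi (u : R) : R := expR u - 1 - u.

Lemma psi_ge0 (u : R) : 0 <= psi u.
Proof. by rewrite /psi -addrA -opprD subr_ge0 expR_ge1Dx. Qed.

Lemma psi0 : psi 0 = 0.
Proof. by rewrite /psi expR0 subrr subr0. Qed.

(** The monotonicity of psi(u) / u^2, in a form that also covers negative u.
    It holds term by term in the power series, since |u|^(n - 2) <= v^(n - 2)
    for n >= 2. *)
Lemma psi_le_sqr (u v : R) : `|u| <= v -> psi u * v ^+ 2 <= psi v * u ^+ 2.
Proof.
move=> uv; have v0 : 0 <= v by rewrite (le_trans _ uv).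
pose S (x : R) (n : nat) : R := series (exp_coeff x) n.+2 - 1 - x.
have S0 (x : R) : S x 0%N = 0.
  by rewrite /S /series/= !big_nat_recr//= big_geq// /exp_coeff/= expr0 expr1
    !fact0 !invr1; lra.
have SS (x : R) n : S x n.+1 = S x n + x ^+ n.+2 / n.+2`!%:R.
  by rewrite /S {1}/series/= big_nat_recr//= /exp_coeff/= /series/=; ring.
have cvgS (x : R) : S x n @[n --> \oo] --> psi x.
  apply: cvgB; last exact: cvg_cst.
  apply: cvgB; last exact: cvg_cst.
  rewrite (cvg_shiftS (fun n => series (exp_coeff x) n.+1)) cvg_shiftS.
  exact: is_cvg_series_exp_coeff.
have le n : S u n * v ^+ 2 <= S v n * u ^+ 2.
  elim: n => [|n IH]; first by rewrite !S0 !mul0r.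
  rewrite !SS [leLHS]mulrDl [leRHS]mulrDl lerD//.
  rewrite [leLHS]mulrAC [leRHS]mulrAC ler_pM2r ?invr_gt0 ?ltr0n ?fact_gt0//.
  have D2 (x : R) : x ^+ n.+2 = x ^+ n * x ^+ 2 by rewrite -exprD addn2.
  rewrite [leLHS](_ : _ = u ^+ n * (u ^+ 2 * v ^+ 2)); last by rewrite D2; ring.
  rewrite [leRHS](_ : _ = v ^+ n * (u ^+ 2 * v ^+ 2)); last by rewrite D2; ring.
  apply: ler_wpM2r; first by rewrite mulr_ge0 ?sqr_ge0.
  by rewrite (le_trans (ler_norm _))// normrX lerXn2r// nnegrE.
apply: (ler_cvg_to (cvgMr_tmp (cvgS u)) (cvgMr_tmp (cvgS v))).
by apply: nearW => n; exact: le.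
Qed.

Lemma psi_le (u v : R) : `|u| <= v -> psi u <= psi v.
Proof.
move=> uv; have [v0|v0] := leP v 0.
  have /eqP -> : u == 0 by rewrite -normr_le0 (le_trans uv).
  by rewrite psi0 psi_ge0.
rewrite -(ler_pM2r (exprn_gt0 2 v0)) (le_trans (psi_le_sqr uv))//.
by rewrite ler_wpM2l ?psi_ge0// -[u ^+ 2]real_normK ?num_real// lerXn2r// nnegrE
  (le_trans _ uv).
Qed.

Lemma continuous_psi : continuous psi.
Proof.
move=> u; apply: cvgB; last exact: cvg_id.
by apply: cvgB; [exact: continuous_expR|exact: cvg_cst].
Qed.

(** The Legendre transform of psi at its optimum, where e^(l c b) = 1 + u. *)
Lemma cramer_exponent (b V c t y : R) : 0 < b -> 0 < V -> 0 < c ->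
    0 < y ->
  let u := b * y / (V ^+ 2 * c) in
  let l := ln (1 + u) / (c * b) in
  - (l * (t * y)) + t * (V ^+ 2 / b ^+ 2 * psi (l * c * b)) =
  - (V ^+ 2 * t / b ^+ 2 * g u).
Proof.
move=> b0 V0 c0 y0 u l.
have u0 : 0 < u by rewrite divr_gt0 ?mulr_gt0 ?exprn_gt0.
have -> : l * c * b = ln (1 + u).
  by rewrite /l; field; rewrite !gt_eqF.
have -> : y = u * (V ^+ 2 * c) / b by rewrite /u; field; rewrite !gt_eqF.
rewrite /psi /g lnK ?posrE ?addr_gt0// /l; field; by rewrite !gt_eqF.
Qed.

(** The Lipschitz constants of the stage rewards follow the recursion
    c_{k+1} = h + e^(-a h) c_k; the sequence C (1 - e^(-a h k)) dominates it
    as soon as h <= C (1 - e^(-a h)), which is e^(a h) >= 1 + a h for this C. *)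
Lemma discount_step (a h C : R) (k : nat) : 0 < a ->
  C = expR (a * h) / a ->
  h + expR (- (a * h)) * (C * (1 - expR (- (a * (h * k%:R))))) <=
  C * (1 - expR (- (a * (h * k.+1%:R)))).
Proof.
move=> a0 CE.
have -> : expR (- (a * (h * k.+1%:R))) =
    expR (- (a * h)) * expR (- (a * (h * k%:R))).
  by rewrite -expRD -natr1; congr expR; ring.
suff : h <= C * (1 - expR (- (a * h))) by move=> ?; lra.
rewrite mulrBr mulr1 CE mulrAC -expRD subrr expR0 -mulrBl ler_pdivlMr//.
by rewrite lerBrDl mulrC expR_ge1Dx.
Qed.

End poisson_function.

(** * Lipschitz functions *)

Section lipschitz_constants.
Context (R : realType) (E : metricType R).
Implicit Types (f g : E -> R) (c : R).

Definition lipc c f := forall x y, `|f x - f y| <= c * mdist x y.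

Lemma lipc_le c c' f : c <= c' -> lipc c f -> lipc c' f.
Proof.
by move=> cc' fc x y; rewrite (le_trans (fc x y))// ler_wpM2r// mdist_ge0.
Qed.

Lemma lipcD c c' f g : lipc c f -> lipc c' g -> lipc (c + c') (f \+ g).
Proof.
move=> fc gc x y /=; rewrite opprD addrACA (le_trans (ler_normD _ _))//.
by rewrite mulrDl lerD.
Qed.

Lemma lipcZ c f (k : R) : 0 <= k -> lipc c f -> lipc (k * c) (fun x => k * f x).
Proof.
by move=> k0 fc x y; rewrite -mulrBr normrM ger0_norm// -mulrA ler_wpM2l.
Qed.

Lemma lipcN c f : lipc c f -> lipc c (\- f).
Proof. by move=> fc x y /=; rewrite -opprD normrN. Qed.

Lemma lipc_mdist x : lipc 1 (mdist x).
Proof.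
move=> y z; rewrite mul1r ler_norml; apply/andP; split.
  have := metric_triangle x y z; lra.
have := metric_triangle x z y; rewrite [mdist z y]metric_sym; lra.
Qed.

Lemma lip_norm_ge0 f : (0 <= lip_norm f)%E.
Proof. by apply: ereal_sup_ubound; left. Qed.

(** The sign condition on c matters on a one-point space, where the seminorm
    is 0 but every c is a Lipschitz constant. *)
Lemma lip_norm_leP f c : 0 <= c -> (lip_norm f <= c%:E)%E <-> lipc c f.
Proof.
move=> c0; split=> [fc x y|fc].
  have [->|xy] := eqVneq x y; first by rewrite subrr normr0 mulr_ge0// mdist_ge0.
  rewrite -ler_pdivrMr ?mdist_gt0// -lee_fin (le_trans _ fc)//.
  by apply: ereal_sup_ubound; right; exists x, y; split => //; exact/eqP.
apply: ub_ereal_sup => _ [->|[x [y [/eqP xy ->]]]]; rewrite lee_fin//.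
by rewrite ler_pdivrMr ?mdist_gt0.
Qed.

Lemma lipc_lip_norm f : Lip f -> lipc (fine (lip_norm f)) f.
Proof.
move=> Lf; have Lfin : lip_norm f \is a fin_num by rewrite ge0_fin_numE ?lip_norm_ge0.
by apply/lip_norm_leP; rewrite ?fine_ge0 ?lip_norm_ge0 ?fineK.
Qed.

Lemma lipc_continuous c f : lipc c f -> continuous f.
Proof.
move=> fc x; apply/cvgrPdist_lt => e e0.
have d0 : 0 < e / (`|c| + 1) by rewrite divr_gt0// ltr_wpDl.
have := @nbhsx_ballx _ _ x _ d0; rewrite ballEmdist/=.
apply: filterS => y /= xy; rewrite (le_lt_trans (fc x y))//.
rewrite (le_lt_trans (y := (`|c| + 1) * mdist x y))//.
  by rewrite ler_wpM2r ?mdist_ge0// (le_trans (ler_norm c))// lerDl.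
by rewrite mulrC -ltr_pdivlMr// ltr_wpDl.
Qed.

Lemma lipc_max c f (a : R) : lipc c f -> lipc c (fun x => Num.max a (f x)).
Proof.
move=> fc x y; rewrite (le_trans _ (fc x y))//.
have := ler_norm (f x - f y); have := ler_norm (f y - f x); rewrite (distrC (f y)).
move: `|f x - f y| (f x) (f y) => d u v uv vu; rewrite ler_norml.
by have [?|?] := ltP a u; have [?|?] := ltP a v; lra.
Qed.

Lemma lipc_min c f (a : R) : lipc c f -> lipc c (fun x => Num.min a (f x)).
Proof.
move=> fc x y; rewrite (le_trans _ (fc x y))//.
have := ler_norm (f x - f y); have := ler_norm (f y - f x); rewrite (distrC (f y)).
move: `|f x - f y| (f x) (f y) => d u v uv vu; rewrite ler_norml.
by have [?|?] := ltP a u; have [?|?] := ltP a v; lra.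
Qed.

End lipschitz_constants.

(** * Extending equalities of integrals from sets to functions *)

Section integral_extension.
Context d1 d2 (T1 : measurableType d1) (T2 : measurableType d2) (R : realType).
Local Open Scope ereal_scope.
Import HBNNSimple.

(** Fubini for a measure nu that is the mixture of the measures k x under mu.
    Both the Markov property and stationarity are given on sets in this form. *)
Lemma integral_mixture (mu : {measure set T1 -> \bar R}) (D : set T1)
    (k : T1 -> {measure set T2 -> \bar R}) (nu : {measure set T2 -> \bar R})
    (f : T2 -> \bar R) :
  measurable D ->
  (forall A, measurable A -> measurable_fun setT (k ^~ A)) ->
  (forall A, measurable A -> \int[mu]_(x in D) k x A = nu A) ->
  (forall y, 0 <= f y) -> measurable_fun setT f ->
  \int[mu]_(x in D) \int[k x]_y f y = \int[nu]_y f y.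
Proof.
move=> mD mk kE f0 mf; pose f_ := nnsfun_approx measurableT mf.
have mEf n : measurable_fun setT (EFin \o f_ n).
  exact/measurable_EFinP.
have nd y : {homo (fun n => (f_ n y)%:E) : m n / (m <= n)%N >-> m <= n}.
  by move=> m n mn; rewrite lee_fin; exact/lefP/nd_nnsfun_approx.
have limE (m : {measure set T2 -> \bar R}) :
    \int[m]_y f y = limn (fun n => \int[m]_y (f_ n y)%:E).
  rewrite -monotone_convergence//; last by move=> n y _; rewrite lee_fin.
  by apply: eq_integral => y _; apply/esym/cvg_lim => //; exact: cvg_nnsfun_approx.
have mi n : measurable_fun setT (fun x => \int[k x]_y (f_ n y)%:E).
  apply: measurable_fun_integral_kernel => //; last exact: mEf.
  by move=> y; rewrite lee_fin.
transitivity (\int[mu]_(x in D) limn (fun n => \int[k x]_y (f_ n y)%:E)).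
  by apply: eq_integral => x _; exact: limE.
rewrite monotone_convergence//; last 3 first.
- by move=> n; exact: measurable_funTS.
- by move=> n x _; apply: integral_ge0 => y _; rewrite lee_fin.
- move=> x _ m n mn; apply: ge0_le_integral => //.
  + by move=> y _; rewrite lee_fin.
  + exact: mEf.
  + exact: mEf.
  + by move=> y _; exact: nd.
rewrite limE; congr (limn _); apply/funext => n.
have simpleE (m : {measure set T2 -> \bar R}) :
    \int[m]_y (f_ n y)%:E = \sum_(r \in range (f_ n)) r%:E * m (f_ n @^-1` [set r]).
  under eq_integral do rewrite fimfunE -fsumEFin//.
  rewrite ge0_integral_fsum//; last 2 first.
  - by move=> r; exact/measurable_EFinP/measurableT_comp.
  - by move=> r y _; rewrite EFinM nnfun_muleindic_ge0.
  apply: eq_fsbigr => r _.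
  rewrite (integralZl_indic _ (fun r => f_ n @^-1` [set r]))//; last first.
    by move=> r0; rewrite preimage_nnfun0.
  by rewrite integral_indic// setIT.
rewrite simpleE; under eq_integral do rewrite simpleE.
rewrite ge0_integral_fsum//; last 2 first.
- move=> r; apply: measurable_funTS; apply: measurable_funeM; exact: mk.
- move=> r x _; apply: (mulemu_ge0 (fun r => f_ n @^-1` [set r])).
  exact: preimage_nnfun0.
apply: eq_fsbigr => r _; have [r0|r0] := leP 0%R r.
  rewrite ge0_integralZl// ?kE//; apply: measurable_funTS; exact: mk.
rewrite preimage_nnfun0// measure0 mule0.
by apply: integral0_eq => x _; rewrite measure0 mule0.
Qed.

End integral_extension.

Section integral_weight.
Context d (T : measurableType d) (R : realType).
Local Open Scope ereal_scope.
Import HBNNSimple.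

(** Z is measurable for the sub-sigma-algebra G alone: this is what passes from
    conditioning on an event of the past to weighting by a functional of the
    past. *)
Lemma eq_integral_weighted (mu : {measure set T -> \bar R}) (G : set (set T))
    (f1 f2 : T -> R) (Z : g_sigma_algebraType G -> R) :
  sigma_algebra setT G -> G `<=` measurable ->
  (forall x, (0 <= f1 x)%R) -> measurable_fun setT f1 ->
  (forall x, (0 <= f2 x)%R) -> measurable_fun setT f2 ->
  (forall B, G B -> \int[mu]_(x in B) (f1 x)%:E = \int[mu]_(x in B) (f2 x)%:E) ->
  (forall x, (0 <= Z x)%R) -> measurable_fun setT Z ->
  \int[mu]_x (Z x * f1 x)%:E = \int[mu]_x (Z x * f2 x)%:E.
Proof.
move=> sG Gm f10 mf1 f20 mf2 f12 Z0 mZ.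
have GE : @measurable _ (g_sigma_algebraType G) = G by exact: sigma_algebra_id.
have GP (B : set (g_sigma_algebraType G)) : measurable B -> G B by rewrite GE.
have mEZ : measurable_fun setT (EFin \o Z) by exact/measurable_EFinP.
have EZ0 x : setT x -> 0 <= (EFin \o Z) x by move=> _; rewrite lee_fin.
pose Z_ := nnsfun_approx measurableT mEZ.
have nd x : {homo Z_^~ x : m n / (m <= n)%N >-> (m <= n)%R}.
  by move=> m n mn; exact/lefP/nd_nnsfun_approx.
have mZn n r : G (Z_ n @^-1` [set r]) by apply: GP; exact: measurable_sfunP.
have mT (g : {nnsfun g_sigma_algebraType G >-> R}) :
    measurable_fun setT (g : T -> R).
  move=> _ Y mY; rewrite setTI; apply/Gm/GP; rewrite -[X in measurable X]setTI.
  exact: measurable_funPT.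
have limE (f : T -> R) : (forall x, (0 <= f x)%R) -> measurable_fun setT f ->
    \int[mu]_x (Z x * f x)%:E =
    limn (fun n => \int[mu]_x ((Z_ n x)%:E * (f x)%:E)).
  move=> f0 mf; rewrite -monotone_convergence//; last 3 first.
  - by move=> n; apply: emeasurable_funM => //; apply/measurable_EFinP => //; exact: mT.
  - by move=> n x _; rewrite mule_ge0// lee_fin.
  - move=> x _ m n mn; rewrite lee_wpmul2r ?lee_fin//.
    exact: nd.
  apply: eq_integral => x _; apply/esym/cvg_lim => //; rewrite EFinM.
  by apply: cvgeZr => //; exact: (cvg_nnsfun_approx _ _ EZ0).
rewrite !limE//; congr (limn _); apply/funext => n.
have simpleE (f : T -> R) : (forall x, (0 <= f x)%R) -> measurable_fun setT f ->
    \int[mu]_x ((Z_ n x)%:E * (f x)%:E) = \sum_(r \in range (Z_ n))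
      r%:E * \int[mu]_(x in Z_ n @^-1` [set r]) (f x)%:E.
  move=> f0 mf.
  transitivity (\int[mu]_x (\sum_(r \in range (Z_ n))
      (r * \1_(Z_ n @^-1` [set r]) x)%:E * (f x)%:E)).
    apply: eq_integral => x _; rewrite -ge0_mule_fsuml => [|r]; last first.
      exact: nnfun_muleindic_ge0.
    by congr (_ * _); rewrite fsumEFin//; congr EFin; exact: fimfunE.
  rewrite ge0_integral_fsum//; last 2 first.
  - move=> r; apply: emeasurable_funM; apply/measurable_EFinP => //.
    by apply: measurable_funM => //; apply: measurable_indic; exact: Gm.
  - move=> r x _; apply: mule_ge0; last by rewrite lee_fin.
    by rewrite EFinM; exact: nnfun_muleindic_ge0.
  apply: eq_fsbigr => r rZ.
  have r0 : (0 <= r)%R by move: rZ; rewrite inE => -[x _ <-].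
  have mB : measurable (Z_ n @^-1` [set r] : set T) by exact: Gm.
  rewrite -ge0_integralZl//; last 2 first.
  - by apply/measurable_EFinP; exact: measurable_funTS.
  - by move=> x _; rewrite lee_fin.
  rewrite [RHS]integral_mkcond; apply: eq_integral => x _.
  by rewrite epatch_indic EFinM -!muleA [(\1_ _ _)%:E * _]muleC.
rewrite !simpleE//; apply: eq_fsbigr => r _; rewrite f12//.
Qed.

End integral_weight.

(** * Trajectories of a jump process *)

Section jump_paths.
Context (R : realType) (dE : measure_display) (E : measurableMetricType R dE).
Variables (w : R -> E).
Hypothesis jump_w : jump_path w.

Lemma jump_path_local (s0 : R) : 0 <= s0 -> exists l, exists2 e : R, 0 < e &
  [/\ forall s, 0 <= s -> s0 - e < s -> s < s0 -> w s = l,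
      forall s, s0 <= s -> s < s0 + e -> w s = w s0 &
      0 < s0 -> lim (w s @[s --> s0^'-]) = l].
Proof.
move=> s00; have [/(_ _ s00) jr jl] := jump_w.
have [e e0 re] : exists2 e : R, 0 < e & forall s, s0 <= s -> s < s0 + e -> w s = w s0.
  have [e /= e0 re] := jr; exists e => // s; rewrite le_eqVlt => /predU1P[->//|s0s] se.
  by apply: re => //=; rewrite distrC gtr0_norm ?subr_gt0// ltrBlDl.
move: s00; rewrite le_eqVlt => /predU1P[s0E|s00].
  rewrite -{}s0E in re *; exists (w 0), e => //.
  split => [s s0' _|s s0' se|]; [|exact: re|by rewrite ltxx].
  by rewrite ltNge s0'.
have [l [e' /= e'0 le]] := jl _ s00.
exists l; exists (Num.min e e'); first by rewrite lt_min e0.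
split=> [s _ se ss0|s s0s se|_].
- apply: le => //=; rewrite gtr0_norm ?subr_gt0//.
  by rewrite ltrBlDr -ltrBlDl (le_lt_trans _ se)// lerB// ge_min lexx orbT.
- by apply: re => //; rewrite (lt_le_trans se)// lerD2l ge_min lexx.
- apply: (@cvg_lim _ (@metric_hausdorff R E)).
  apply: cvg_near_cst; exists e' => //= s; exact: le.
Qed.

(** A step function takes finitely many values on [0, t], so a property of
    states that holds eventually at each state holds eventually along the whole
    trajectory. Compactness of [0, t] spares the list of the jump times. *)
Lemma jump_path_near_range (B : nat -> set E) (t : R) :
  (forall z, \forall n \near \oo, B n z) ->
  \forall n \near \oo, forall s, 0 <= s <= t -> B n (w s).
Proof.
move=> Bz.
have /compact_near_coveringP/near_covering_withinP := @segment_compact R 0 t.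
move=> /(_ nat \oo (fun n s => B n (w s)) _)[].
  move=> s0; rewrite /= in_itv/= => /andP[s00 _].
  have [l [e e0 [we1 we2 _]]] := jump_path_local s00.
  exists (ball s0 e, fun n => B n l /\ B n (w s0)).
    by split; [exact: nbhsx_ballx|apply: filterI; exact: Bz].
  move=> [s n] /= [+ [Bl Bs0]]; rewrite /ball/= in_itv/= => ss0 /andP[s_ge0 _].
  move: ss0; rewrite ltr_norml => /andP[? ?].
  have [ss0|ss0] := ltP s s0; first by rewrite (we1 s)//; lra.
  by rewrite (we2 s)//; lra.
move=> N _ BN; exists N => // n Nn s st; apply: BN => //=.
Qed.

(** On a fine enough grid at most one jump occurs between consecutive points,
    so the increments inherit the bound on the jumps. *)
Lemma jump_path_steps_le (b t : R) : 0 <= b ->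
  (forall s, 0 < s -> mdist (left_lim w s) (w s) <= b) ->
  \forall h \near 0^'+, forall s, 0 <= s <= t -> mdist (w s) (w (s + h)) <= b.
Proof.
move=> b0 jb.
have /compact_near_coveringP/near_covering_withinP := @segment_compact R 0 t.
move=> /(_ R 0^'+ (fun h s => mdist (w s) (w (s + h)) <= b) _) H.
apply: filterS (H _) => [h bh s st|]; first by apply: bh.
move=> s0; rewrite /= in_itv/= => /andP[s00 _].
have [l [e e0 [we1 we2 wl]]] := jump_path_local s00.
exists (ball s0 (e / 2), fun h => 0 < h /\ h < e / 2).
  split; first by apply: nbhsx_ballx; rewrite divr_gt0.
  apply: filterI; [exact: nbhs_right_gt|apply: nbhs_right_lt].
  by rewrite divr_gt0.
move=> [s h] /= [+ [h0 he]]; rewrite /ball/= in_itv/= => ss0 /andP[s_ge0 _].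
move: ss0; rewrite ltr_norml => /andP[? ?].
have [ss0|ss0] := ltP s s0; last first.
  by rewrite (we2 s) ?(we2 (s + h)) ?mdistxx//; lra.
rewrite (we1 s)//; last lra.
have [shs0|shs0] := ltP (s + h) s0.
  by rewrite (we1 (s + h)) ?mdistxx//; lra.
rewrite (we2 (s + h))//; last lra.
by rewrite -wl ?jb//; lra.
Qed.

End jump_paths.

(** * Riemann sums of right-continuous step functions *)

Lemma integrable_of_le_norm d (T : measurableType d) (R : realType)
    (mu : {measure set T -> \bar R}) (D : set T) (f : T -> R) (M : R) :
  measurable D -> (mu D < +oo)%E -> measurable_fun D f ->
  (forall x, D x -> `|f x| <= M) -> mu.-integrable D (EFin \o f).
Proof.
move=> mD muD mf fM; apply: measurable_bounded_integrable => //.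
exists M; split; first exact: num_real.
by move=> r Mr x Dx /=; rewrite (le_trans (fM x Dx))// ltW.
Qed.

Lemma near_step (R : realType) (t : R) (P : set R) : 0 < t ->
  (\forall h \near 0^'+, P h) -> \forall n \near \oo, P (t / n.+1%:R).
Proof.
move=> t0 [e /= e0 Pe]; have et0 : 0 < e / t by rewrite divr_gt0.
apply: filterS (near_infty_natSinv_lt (PosNum et0)) => n /= ne.
apply: Pe => /=; last by rewrite divr_gt0.
by rewrite sub0r normrN gtr0_norm ?divr_gt0// mulrC -ltr_pdivlMr.
Qed.

Section riemann_sums.
Context (R : realType).
Local Notation mu := (@lebesgue_measure R).

(** Right endpoints: the sampled times approach s from the right, where the
    trajectory is constant, so that convergence holds at every s. *)
Definition riemann_sum (f : R -> R) (t : R) (n : nat) : R :=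
  t / n.+1%:R * \sum_(k < n.+1) f (t / n.+1%:R * k.+1%:R).

Lemma cvg_riemann_sum (f : R -> R) (M t : R) : 0 < t ->
  (forall s, 0 <= s -> \forall s' \near s^'+, f s' = f s) ->
  (forall s, `|f s| <= M) ->
  riemann_sum f t n @[n --> \oo] --> \int[mu]_(s in `[0, t]) f s.
Proof.
move=> t0 fr fM.
have M0 : 0 <= M by rewrite (le_trans (normr_ge0 _) (fM 0)).
pose h n : R := t / n.+1%:R.
have h0 n : 0 < h n by rewrite divr_gt0.
pose I n (k : nat) : set R := [set` `[h n * k%:R, h n * k.+1%:R[].
pose F n (s : R) : R := \sum_(k < n.+1) f (h n * k.+1%:R) * \1_(I n k) s.
pose D : set R := [set` `[0, t[].
have mD : measurable D by exact: measurable_itv.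
have muD : (mu D < +oo)%E by rewrite lebesgue_measure_itv/= lte_fin t0 -EFinB ltry.
have FE n s : D s -> F n s = f (h n * (Num.truncn (s / h n)).+1%:R).
  rewrite /D/= in_itv/= => /andP[s0 st].
  set k := Num.truncn _.
  have /andP[ks sk] : k%:R <= s / h n < k.+1%:R.
    by apply: truncn_itv; rewrite divr_ge0// ltW.
  have kn : (k < n.+1)%N.
    rewrite -(ltr_nat R) (le_lt_trans ks)// ltr_pdivrMr// /h mulrCA divff ?mulr1//.
  rewrite /F (bigD1 (Ordinal kn))//= [X in _ + X]big1 ?addr0.
    rewrite indicE mem_set ?mulr1//= /I/= in_itv/=.
    by rewrite ![h n * _]mulrC -ler_pdivlMr// ks/= -ltr_pdivrMr.
  move=> j /eqP jk; rewrite indicE memNset ?mulr0//= /I/= in_itv/=.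
  move=> /andP[js sj].
  have {}js : j%:R <= s / h n by rewrite ler_pdivlMr// mulrC.
  have {}sj : s / h n < j.+1%:R by rewrite ltr_pdivrMr// mulrC.
  apply: jk; apply/val_inj => /=; apply/eqP; rewrite eqn_leq.
  have := le_lt_trans ks sj; have := le_lt_trans js sk; rewrite !ltr_nat !ltnS.
  by move=> -> ->.
have mF n : measurable_fun setT (F n).
  apply: measurable_sum => k; apply: measurable_funM => //.
  by apply: measurable_indic; exact: measurable_itv.
have FM n s : D s -> `|F n s| <= M by move=> Ds; rewrite FE.
have Ff s : D s -> F n s @[n --> \oo] --> f s.
  move=> Ds; move: (Ds); rewrite /D/= in_itv/= => /andP[s0 st].
  have [e /= e0 fe] := fr _ s0.
  apply: cvg_near_cst.
  have := near_step t0 (nbhs_right_lt e0); apply: filterS => n he; rewrite FE//.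
  rewrite -natr1; have /andP[ks sk] : (Num.truncn (s / h n))%:R <= s / h n <
      (Num.truncn (s / h n)).+1%:R.
    by apply: truncn_itv; rewrite divr_ge0// ltW.
  move: ks sk; rewrite ler_pdivlMr// ltr_pdivrMr// -natr1 => ks sk.
  by apply: fe => /=; [rewrite distrC ger0_norm|]; rewrite -/(h n) in he *; lra.
have mf : measurable_fun D f.
  by apply: (measurable_fun_cvg (h := F)) => // n; exact: measurable_funTS.
have intf : mu.-integrable D (EFin \o f) by exact: (integrable_of_le_norm (M := M)).
rewrite -Rintegral_itv_bndo_bndc//.
have -> : riemann_sum f t = fun n => \int[mu]_(s in D) F n s.
  apply/funext => n; rewrite /riemann_sum -/(h n) /Rintegral.
  have intI (k : 'I_n.+1) : mu.-integrable D (EFin \o (\1_(I n k) : R -> R)).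
    apply: (integrable_of_le_norm (M := 1)) => //.
      by apply: measurable_indic; exact: measurable_itv.
    by move=> s _; rewrite ger0_norm// indicE; case: (_ \in _).
  under eq_integral do rewrite /F -sumEFin.
  rewrite integral_sum//; last first.
    move=> k; have := @integrableZl _ _ _ mu D mD (f (h n * k.+1%:R)) _ (intI k).
    exact: eq_integrable.
  rewrite mulr_sumr -[LHS]/(fine _%:E) -sumEFin; congr fine; apply: eq_bigr => k _.
  under eq_integral do rewrite EFinM.
  have mI : measurable (I n k) by exact: measurable_itv.
  rewrite integralZl//; last exact: intI.
  rewrite (@integral_indic _ _ R mu D mD _ mI) (_ : I n k `&` D = I n k); last first.
    apply/setIidPl => s; rewrite /I/D/= !in_itv/= => /andP[ks sk].
    apply/andP; split; first by rewrite (le_trans _ ks)// mulr_ge0// ltW.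
    rewrite (lt_le_trans sk)// /h -mulrA ler_piMr ?(ltW t0)// mulrC.
    by rewrite ler_pdivrMr// mul1r ler_nat.
  have muI : mu (I n k) = (h n)%:E.
    rewrite /I lebesgue_measure_itv/= lte_fin ltr_pM2l// ltr_nat ltnSn -EFinB.
    by congr EFin; rewrite -natr1; ring.
  by rewrite EFinM muleC; congr (_ * _)%E.
apply: fine_cvg.
rewrite fineK; last exact: integrable_fin_num.
have [] := @dominated_convergence _ _ _ mu D mD
  (fun n => EFin \o F n) (EFin \o f) (cst M%:E).
- by move=> n; apply/measurable_EFinP; apply: (measurable_funTS (mF n)).
- exact/measurable_EFinP.
- apply: aeW => s Ds; apply: cvg_EFin; last exact: Ff.
  exact: nearW.
- by apply: (integrable_of_le_norm (M := M) (f := cst M)) => // s _ /=; rewrite ger0_norm.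
- by apply: aeW => s n Ds /=; rewrite lee_fin FM.
- by move=> _ _.
Qed.

End riemann_sums.

(** * The Markov property for bounded functions *)

Lemma lipc_measurable (R : realType) dE (E : measurableMetricType R dE)
    (c : R) (f : E -> R) :
  borel_sigma_algebra E -> lipc c f -> measurable_fun setT f.
Proof.
move=> borelE /lipc_continuous/continuousP cf.
apply: (measurability _ (RGenOpens.measurableE R)) => _ [_ [a [b ->] <-]].
rewrite setTI borelE; apply: sub_sigma_algebra.
exact/cf/interval_open.
Qed.

Section expectation_of_bounded.
Context d (T : measurableType d) (R : realType).

Definition bdd_measurable (f : T -> R) :=
  measurable_fun setT f /\ exists M, forall x, `|f x| <= M.

Lemma bdd_measurableD f g : bdd_measurable f -> bdd_measurable g ->
  bdd_measurable (f \+ g).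
Proof.
move=> [mf [M fM]] [mg [N gN]]; split; first exact: measurable_funD.
by exists (M + N) => x; rewrite (le_trans (ler_normD _ _))// lerD.
Qed.

Lemma bdd_measurableZ k f : bdd_measurable f -> bdd_measurable (fun x => k * f x).
Proof.
move=> [mf [M fM]]; split; first exact: measurable_funM.
by exists (`|k| * M) => x; rewrite normrM ler_wpM2l.
Qed.

Lemma bdd_measurable_cst k : bdd_measurable (fun=> k).
Proof. by split => //; exists `|k|. Qed.

Lemma bdd_measurable_expR f : bdd_measurable f ->
  bdd_measurable (fun x => expR (f x)).
Proof.
move=> [mf [M fM]]; split; first exact: measurableT_comp.
exists (expR M) => x; rewrite ger0_norm ?expR_ge0// ler_expR.
exact: le_trans (ler_norm _) (fM x).
Qed.

Lemma bdd_measurable_integrable (mu : {finite_measure set T -> \bar R}) f :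
  bdd_measurable f -> mu.-integrable setT (EFin \o f).
Proof.
move=> [mf [M fM]]; apply: (integrable_of_le_norm (M := M)) => //.
exact: fin_num_fun_lty.
Qed.

Lemma EFin_Rintegral (mu : {finite_measure set T -> \bar R}) f :
  bdd_measurable f -> (\int[mu]_x f x)%:E = (\int[mu]_x (f x)%:E)%E.
Proof.
move=> bf; rewrite /Rintegral fineK//; apply: integrable_fin_num => //.
exact: bdd_measurable_integrable.
Qed.

End expectation_of_bounded.

Section markov.
Context (R : realType) (dE dO : measure_display)
        (E : measurableMetricType R dE) (Omega : measurableType dO).
Variables (F : R -> set (set Omega)) (P : E -> probability Omega R)
          (X : R -> {mfun Omega >-> E}).
Local Notation T := (semigroup P X).

Lemma EFin_semigroup h f x : bdd_measurable f ->
  (T h f x)%:E = (\int[transition P X h x]_y (f y)%:E)%E.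
Proof. exact: EFin_Rintegral. Qed.

Lemma semigroupD h f g x : bdd_measurable f -> bdd_measurable g ->
  T h (f \+ g) x = T h f x + T h g x.
Proof. by move=> bf bg; apply: RintegralD => //; exact: bdd_measurable_integrable. Qed.

Lemma semigroupZ h k f x : bdd_measurable f ->
  T h (fun y => k * f y) x = k * T h f x.
Proof. by move=> bf; apply: RintegralZl => //; exact: bdd_measurable_integrable. Qed.

Lemma semigroup_cst h k x : T h (fun=> k) x = k.
Proof.
by rewrite /semigroup Rintegral_cst// [X in fine X]probability_setT mulr1.
Qed.

Lemma semigroup_le h f g x : bdd_measurable f -> bdd_measurable g ->
  (forall y, f y <= g y) -> T h f x <= T h g x.
Proof.
by move=> bf bg fg; apply: le_Rintegral => //; exact: bdd_measurable_integrable.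
Qed.

Lemma semigroup_norm_le h f M x : bdd_measurable f -> (forall y, `|f y| <= M) ->
  `|T h f x| <= M.
Proof.
move=> bf fM; rewrite ler_norml; apply/andP; split.
  rewrite -(semigroup_cst h (- M) x); apply: semigroup_le => //.
    exact: bdd_measurable_cst.
  by move=> y; have := fM y; rewrite ler_norml => /andP[].
rewrite -[leRHS](semigroup_cst h M x); apply: semigroup_le => //.
  exact: bdd_measurable_cst.
by move=> y; rewrite (le_trans (ler_norm _)).
Qed.

Hypothesis markovX : markov_process P X F.

Lemma expectation0 f x : bdd_measurable f -> (forall y, 0 <= f y) ->
  (\int[P x]_w (f (X 0 w))%:E = (f x)%:E)%E.
Proof.
move=> [mf _] f0; have [_ _ _ /(_ x) X0 _] := markovX.
rewrite (ae_eq_integral (cst (f x)%:E))//.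
- by rewrite integral_cst// [X in (_ * X)%E]probability_setT mule1.
- by apply/measurable_EFinP; apply: measurableT_comp.
- by apply: filterS X0 => w Xw _; rewrite /= Xw.
Qed.

Lemma semigroup_ge0_bdd h f : 0 <= h -> bdd_measurable f ->
  (forall y, 0 <= f y) -> bdd_measurable (T h f).
Proof.
move=> h0 bf f0; have [mf [M fM]] := bf; split; last first.
  by exists M => x; exact: semigroup_norm_le.
apply/measurable_EFinP.
rewrite (_ : EFin \o _ = fun x => \int[transition P X h x]_y (f y)%:E)%E; last first.
  by apply/funext => x; exact: EFin_semigroup.
have [_ _ mP _ _] := markovX.
apply: (measurable_fun_integral_kernel (l := fun x => transition P X h x)) => //.
- by move=> A mA; exact: mP.
- by apply/measurable_EFinP; case: bf.
Qed.

Lemma semigroup_bdd h f : 0 <= h -> bdd_measurable f -> bdd_measurable (T h f).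
Proof.
move=> h0 bf; have [_ [M fM]] := bf.
have bM (k : R) : bdd_measurable (fun _ : E => k) by exact: bdd_measurable_cst.
have bfM : bdd_measurable (f \+ (fun=> M)) by exact: bdd_measurableD.
rewrite (_ : T h f = T h (f \+ (fun=> M)) \+ (fun=> - M)); last first.
  by apply/funext => x /=; rewrite semigroupD// semigroup_cst addrK.
apply: bdd_measurableD => //; apply: semigroup_ge0_bdd => // y /=.
by have := fM y; rewrite ler_norml => /andP[]; lra.
Qed.

(** Both sides integrate f against the law of X_{s+h} restricted to B: the left
    one as a mixture of Dirac masses, the right one as a mixture of the
    transition probabilities. *)
Lemma markov_integral_set x s h (B : set Omega) f : 0 <= s -> 0 <= h -> F s B ->
  bdd_measurable f -> (forall y, 0 <= f y) ->
  (\int[P x]_(w in B) (f (X (s + h) w))%:E =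
   \int[P x]_(w in B) (T h f (X s w))%:E)%E.
Proof.
move=> s0 h0 FB bf f0; have [[_ Fm _] _ mP _ mk] := markovX.
have mB : measurable B by exact: (Fm s).
have mf : measurable_fun setT (EFin \o f) by apply/measurable_EFinP; case: bf.
pose nu := pushforward (mrestr (P x) mB) (X (s + h)).
have f0E y : (0 <= (f y)%:E)%E by rewrite lee_fin.
transitivity (\int[nu]_y (f y)%:E)%E; last first.
  under [RHS]eq_integral do rewrite EFin_semigroup//.
  apply/esym.
  apply: (integral_mixture (k := fun w => transition P X h (X s w))) => //.
    by move=> A mA; apply: (measurableT_comp (mP _ _ h0 mA)).
  by move=> A mA; rewrite -(mk x s h B A)// /nu /pushforward /mrestr/= setIC.
rewrite -(integral_mixture (mu := P x) (k := fun w => \d_(X (s + h) w)) mB)//.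
- by apply: eq_integral => w _; rewrite integral_dirac//= diracT mul1e.
- move=> A mA; rewrite (_ : (fun w => _) = (fun w => (\1_A (X (s + h) w))%:E))//.
  by apply/measurable_EFinP; apply: measurableT_comp => //; exact: measurable_indic.
- move=> A mA; rewrite (eq_integral (fun w => (\1_(X (s + h) @^-1` A) w)%:E))//.
  rewrite integral_indic; [exact: erefl|exact: mB|].
  by rewrite -[X in measurable X]setTI; exact: measurable_funPT.
Qed.

Lemma markov_integral x s h f (Z : g_sigma_algebraType (F s) -> R) :
  0 <= s -> 0 <= h -> bdd_measurable f -> (forall y, 0 <= f y) ->
  (forall w, 0 <= Z w) -> measurable_fun setT Z ->
  (\int[P x]_w (Z w * f (X (s + h) w))%:E =
   \int[P x]_w (Z w * T h f (X s w))%:E)%E.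
Proof.
move=> s0 h0 bf f0 Z0 mZ; have [[sF Fm _] _ _ _ _] := markovX.
have bT := semigroup_ge0_bdd h0 bf f0.
apply: (eq_integral_weighted (G := F s)) => //.
- exact: sF.
- exact: Fm.
- by apply: measurableT_comp => //; case: bf.
- move=> w; rewrite -(semigroup_cst h 0 (X s w)); apply: semigroup_le => //.
  exact: bdd_measurable_cst.
- by apply: measurableT_comp => //; case: bT.
- by move=> B FB; exact: markov_integral_set.
Qed.

Lemma stationary_Rintegral (pi : probability E R) h f : stationary P X pi ->
  0 <= h -> bdd_measurable f -> \int[pi]_x T h f x = \int[pi]_x f x.
Proof.
move=> statpi h0 bf; have [mf [M fM]] := bf.
have bM (k : R) : bdd_measurable (fun _ : E => k) by exact: bdd_measurable_cst.
have bfM : bdd_measurable (f \+ (fun=> M)) by exact: bdd_measurableD.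
have fM0 y : 0 <= (f \+ (fun=> M)) y.
  by rewrite /=; have := fM y; rewrite ler_norml => /andP[]; lra.
have H : \int[pi]_x T h (f \+ (fun=> M)) x = \int[pi]_x (f \+ (fun=> M)) x.
  rewrite /Rintegral; congr fine.
  under eq_integral do rewrite EFin_semigroup//.
  have [_ _ mP _ _] := markovX.
  apply: (integral_mixture (k := transition P X h)) => //.
  - by move=> A mA; exact: mP.
  - by move=> A mA; exact: statpi.
  - by apply/measurable_EFinP; case: bfM.
have TE : T h (f \+ (fun=> M)) = T h f \+ (fun=> M).
  by apply/funext => x /=; rewrite semigroupD// semigroup_cst.
move: H; rewrite TE /= RintegralD//; last 2 first.
- by apply: bdd_measurable_integrable; exact: semigroup_bdd.
- exact: bdd_measurable_integrable.
rewrite RintegralD//; [exact: addIr|exact: bdd_measurable_integrable|].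
exact: bdd_measurable_integrable.
Qed.

Lemma filtration_measurable (s : R) (Z : Omega -> R) : 0 <= s ->
  measurable_fun setT (Z : g_sigma_algebraType (F s) -> R) ->
  measurable_fun setT Z.
Proof.
move=> s0 mZ _ Y mY; have [[sF Fm _] _ _ _ _] := markovX.
apply: (Fm _ s0); rewrite -(sigma_algebra_id (sF _ s0)); exact: mZ.
Qed.

Lemma measurable_at (s r : R) (f : E -> R) : 0 <= r -> r <= s ->
  measurable_fun setT f ->
  measurable_fun setT (fun w : g_sigma_algebraType (F s) => f (X r w)).
Proof.
move=> r0 rs mf; have [[_ _ Fmono] FX _ _ _] := markovX.
move=> _ Y mY; rewrite setTI; apply: sub_sigma_algebra.
apply: (Fmono r s) => //; apply: (FX r (f @^-1` Y)) => //.
by rewrite -[X in measurable X]setTI; exact: mf.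
Qed.

End markov.

(** * Contraction of the Lipschitz seminorm *)

Section curvature.
Context (R : realType) (dE dO : measure_display)
        (E : measurableMetricType R dE) (Omega : measurableType dO).
Variables (P : E -> probability Omega R) (X : R -> {mfun Omega >-> E}).
Local Notation T := (semigroup P X).

Lemma lip_norm_normalize (f : E -> R) (r : R) : 0 < r -> lip_norm f = r%:E ->
  lip_norm (fun x => r^-1 * f x) = 1%E.
Proof.
move=> r0 fr; have rf : lipc r f by apply/lip_norm_leP; rewrite ?fr// ltW.
apply/eqP; rewrite eq_le; apply/andP; split.
  apply/lip_norm_leP => //; rewrite -(mulVf (lt0r_neq0 r0)).
  by apply: lipcZ => //; rewrite invr_ge0 ltW.
rewrite leNgt; apply/negP => lt1.
have fin : lip_norm (fun x => r^-1 * f x) \is a fin_num.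
  by rewrite ge0_fin_numE ?lip_norm_ge0// (lt_trans lt1)// ltry.
move: lt1; rewrite -(fineK fin); set s := fine _; rewrite lte_fin => s1.
have s0 : 0 <= s by rewrite fine_ge0 ?lip_norm_ge0.
have : lipc s (fun x => r^-1 * f x) by apply/lip_norm_leP; rewrite ?fineK.
move=> /(lipcZ (ltW r0)) H.
have : lipc (r * s) f.
  by move=> x y; have := H x y; rewrite !mulrA !divff ?gt_eqF// !mul1r.
move/(lip_norm_leP _ (mulr_ge0 (ltW r0) s0)); rewrite fr lee_fin => rs.
have : r * s < r * 1 by rewrite ltr_pM2l.
by rewrite mulr1 ltNge rs.
Qed.

(** The curvature is a limit at 0, so any a < sigma is a contraction rate of
    P_h for all small h; the proof of the deviation bound only runs P_h on fine
    grids and lets a tend to sigma at the end. *)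
Lemma curvature_contraction (sigma a : R) : is_wasserstein_curvature P X sigma ->
  a < sigma ->
  \forall h \near 0^'+, forall f c, bdd_measurable f -> 0 <= c -> lipc c f ->
    lipc (expR (- (a * h)) * c) (T h f).
Proof.
move=> curv asigma.
have H : \forall h \near 0^'+, (a%:E < sigma_bar P X h * (h^-1)%:E)%E.
  apply: (curv [set x | (a%:E < x)%E]).
  by apply: open_nbhs_nbhs; split; [exact: open_ereal_gt_ereal|rewrite /= lte_fin].
have : \forall h \near (0 : R)^'+, 0 < h by exact: nbhs_right_gt.
apply: filterS2 H => h + h0 f c bf c0 fc.
rewrite lte_pdivlMr// -EFinM /sigma_bar lteNr => supa.
have : (lip_norm f <= c%:E)%E by apply/lip_norm_leP.
move=> normf; have fin : lip_norm f \is a fin_num.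
  by rewrite ge0_fin_numE ?lip_norm_ge0// (le_lt_trans normf)// ltry.
move: normf; rewrite -(fineK fin) lee_fin => rc.
have := lip_norm_ge0 f; rewrite -(fineK fin) lee_fin le_eqVlt => /predU1P[r0|r0].
  have f0 x y : f x = f y.
    apply/eqP; rewrite -subr_eq0 -normr_le0 -[leRHS](mul0r (mdist x y)) r0.
    by apply: lipc_lip_norm; rewrite /Lip/= -(fineK fin) ltry.
  move=> x y; rewrite (_ : f = fun=> f x); last by apply/funext => z; exact: f0.
  by rewrite !semigroup_cst subrr normr0 !mulr_ge0 ?expR_ge0 ?mdist_ge0.
set r := fine _ in r0 rc.
pose f' x := r^-1 * f x.
have f'1 : lip_norm f' = 1%E by apply: lip_norm_normalize => //; rewrite fineK.
have : (lip_norm (T h f') <= (expR (- (a * h)))%:E)%E.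
  have /eqP <- : expeR (lne (lip_norm (T h f'))) == lip_norm (T h f').
    by rewrite lneK_eq lip_norm_ge0.
  rewrite -[leRHS]/(expeR (- (a * h))%:E) lee_expeR (le_trans _ (ltW supa))//.
  by apply: ereal_sup_ubound => /=; exists f'.
move=> /(lip_norm_leP _ (expR_ge0 _)) Tf'.
apply: (lipc_le (c := r * expR (- (a * h)))).
  by rewrite mulrC ler_wpM2l ?expR_ge0.
have := lipcZ (ltW r0) Tf'; congr lipc; apply/funext => x.
by rewrite /f' semigroupZ// mulrA divff ?gt_eqF// mul1r.
Qed.

End curvature.

(** * The jump kernel does not charge jumps larger than b *)

Lemma bernoulli_exprn (R : realType) (e : R) n : 0 <= e <= 1 ->
  1 - e *+ n <= (1 - e) ^+ n.
Proof.
move=> /andP[e0 e1]; elim: n => [|n IH]; first by rewrite mulr0n subr0 expr0.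
rewrite exprS (le_trans _ (ler_wpM2l _ IH)) ?subr_ge0//.
have : 0 <= e * (e *+ n) by rewrite mulr_ge0// mulrn_wge0.
by rewrite mulrS; lra.
Qed.

Section big_jumps.
Context (R : realType) (dE dO : measure_display)
        (E : measurableMetricType R dE) (Omega : measurableType dO).
Variables (F : R -> set (set Omega)) (P : E -> probability Omega R)
          (X : R -> {mfun Omega >-> E}) (Q : R.-ker E ~> E).
Hypothesis borelE : borel_sigma_algebra E.
Hypothesis markovX : markov_process P X F.
Hypothesis jumpX : forall w, jump_path (X ^~ w).
Hypothesis stableQ : stable_conservative P X Q.

Lemma measurable_mdist_gt (z : E) (b : R) : measurable [set y | b < mdist z y].
Proof.
rewrite (_ : [set _ | _] = setT `&` mdist z @^-1` [set` `]b, +oo[]).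
  by apply: (lipc_measurable borelE (lipc_mdist z)) => //; exact: measurable_itv.
by rewrite setTI; apply/seteqP; split=> y /=; rewrite in_itv/= andbT.
Qed.

Lemma measurable_singleton (z : E) : measurable [set z].
Proof.
rewrite (_ : [set z] = ~` [set y | 0 < mdist z y]); last first.
  apply/seteqP; split=> [y ->/=|y /=]; first by rewrite mdistxx ltxx.
  by move=> /negP; rewrite mdist_gt0 negbK => /eqP.
by apply: measurableC; exact: measurable_mdist_gt.
Qed.

Definition rests (z : E) (h : R) (k : nat) : set Omega :=
  [set w | forall j, (j <= k)%N -> X (h * j%:R) w = z].

Lemma restsS z h k :
  rests z h k.+1 = rests z h k `&` X (h * k%:R + h) @^-1` [set z].
Proof.
have hS : h * k%:R + h = h * k.+1%:R by rewrite -natr1 mulrDr mulr1.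
rewrite hS; apply/seteqP; split=> [w H|w [H1 H2] j].
  by split=> [j jk|]; apply: H => //; exact: leqW.
by rewrite leq_eqVlt => /predU1P[->//|]; exact: H1.
Qed.

Lemma filtration_rests z h k : 0 <= h -> F (h * k%:R) (rests z h k).
Proof.
move=> h0; have [[sF _ Fmono] FX _ _ _] := markovX.
elim: k => [|k IH].
  rewrite (_ : rests z h 0 = X (h * 0%:R) @^-1` [set z]).
    by apply: FX; rewrite ?mulr0//; exact: measurable_singleton.
  apply/seteqP; split=> [w H|w H j]; first exact: H.
  by rewrite leqn0 => /eqP ->.
have hS : h * k%:R + h = h * k.+1%:R by rewrite -natr1 mulrDr mulr1.
have hk0 : 0 <= h * k%:R by rewrite mulr_ge0.
rewrite restsS hS.
have /(sigma_algebraP (fun _ _ => @subsetT _ _))[_ _ _ FI] :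
    sigma_algebra setT (F (h * k.+1%:R)).
  by apply: sF; rewrite mulr_ge0.
apply: FI; last by apply: FX; [rewrite mulr_ge0|exact: measurable_singleton].
by apply: Fmono IH => //; rewrite -hS lerDl.
Qed.

Lemma markov_rests x z h k (A : set E) : 0 <= h -> measurable A ->
  (P x (rests z h k `&` X (h * k%:R + h) @^-1` A) =
   transition P X h z A * P x (rests z h k))%E.
Proof.
move=> h0 mA; have [[_ Fm _] _ _ _ mk] := markovX.
have hk0 : 0 <= h * k%:R by rewrite mulr_ge0.
have FB := filtration_rests z k h0.
rewrite mk//; under eq_integral => w /[!inE] H do rewrite (H k (leqnn k)).
rewrite -[X in (_ = _ * X)%E]/(P x _) integral_cst//; exact: Fm FB.
Qed.

Lemma prob_rests z h k : 0 <= h ->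
  P z (rests z h k) = (fine (transition P X h z [set z]) ^+ k)%:E.
Proof.
move=> h0; elim: k => [|k IH].
  have mz := measurable_singleton z.
  have bz : bdd_measurable (\1_[set z] : E -> R).
    split; first exact: measurable_indic.
    by exists 1 => y; rewrite ger0_norm// indicE; case: (_ \in _).
  have := expectation0 markovX z bz (fun y => ler0n _ _).
  rewrite indicE mem_set// expr0 => <-.
  rewrite (eq_integral (fun w => (\1_(X 0 @^-1` [set z]) w)%:E))//.
  rewrite integral_indic//; last first.
    by rewrite -[X in measurable X]setTI; exact: measurable_funPT.
  rewrite setIT; congr (P z _); apply/seteqP; split=> [w H|w H j].
    by have := H 0%N isT; rewrite mulr0.
  by rewrite leqn0 => /eqP ->; rewrite mulr0.
rewrite restsS markov_rests// ?IH; last exact: measurable_singleton.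
by rewrite exprS EFinM fineK// fin_num_measure//; exact: measurable_singleton.
Qed.

(** The events that the sampled chain leaves z for a point of A exactly at step
    k + 1 are disjoint, and each has probability p^k P_h(z, A). *)
Lemma rests_then_lower_bound z h n (A : set E) : 0 <= h -> measurable A -> ~ A z ->
  let p := fine (transition P X h z [set z]) in
  let E_ := \big[setU/set0]_(k < n.+1) (rests z h k `&` X (h * k%:R + h) @^-1` A) in
  measurable E_ /\
  ((p ^+ n * fine (transition P X h z A) *+ n.+1)%:E <= P z E_)%E.
Proof.
move=> h0 mA Az p E_.
pose C (k : nat) := rests z h k `&` X (h * k%:R + h) @^-1` A.
have mC k : measurable (C k).
  apply: measurableI; last by rewrite -[X in measurable X]setTI; exact: measurable_funPT.
  have [[_ Fm _] _ _ _ _] := markovX.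
  by apply: (Fm _ _ _ (filtration_rests z k h0)); rewrite mulr_ge0.
split; first by apply: bigsetU_measurable => k _; exact: mC.
have tC : trivIset setT C.
  apply/trivIsetP => i j _ _; wlog ij : i j / (i < j)%N.
    move=> H; rewrite neq_ltn => /orP[ij|ji].
      by apply: H => //; rewrite neq_ltn ij.
    by rewrite setIC; apply: H => //; rewrite neq_ltn ji.
  move=> _; rewrite -subset0 => w [[_ Ai] [rj _]]; apply: Az.
  by rewrite -(rj i.+1 ij) -natr1 mulrDr mulr1.
rewrite (measure_bigsetU (P z) mC tC n.+1).
have p01 : 0 <= p <= 1.
  rewrite /p fine_ge0//= -lee_fin fineK ?fin_num_measure//;
    try exact: measurable_singleton.
  by apply: probability_le1; exact: measurable_singleton.
rewrite -[X in _ *+ X](card_ord n.+1) -sumr_const -sumEFin.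
apply: lee_sum => -[k /= kn] _.
rewrite /C markov_rests// prob_rests// muleC.
rewrite -[leRHS](@fineK R) ?fin_numM ?fin_num_measure//.
rewrite fineM ?fin_num_measure//= lee_fin ler_wpM2r ?fine_ge0//.
by case/andP: p01 => p0 p1; rewrite ler_wiXn2l.
Qed.

(** Let a = Q(z, {d(z, .) > b}) and suppose a > 0. For t0 = 1 / (2 (Q(z, E) + 1))
    the chain sampled with step t0 / n stays at z during n steps with
    probability at least 1/2, and each step makes a jump larger than b with
    probability about a t0 / n; so before t0 the sampled chain jumps directly
    from z to a point beyond distance b with probability at least a t0 / 4.
    But almost every trajectory has no such sampled step when n is large, hence
    the probability tends to 0. *)
Lemma kernel_no_big_jump (z : E) (b : R) : 0 < b ->
  {ae P z, forall w, forall t, 0 < t ->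
    mdist (left_lim (X ^~ w) t) (X t w) <= b} ->
  Q z [set y | b < mdist z y] = 0%E.
Proof.
move=> b0 jumps; have [Qfin stab] := stableQ.
set A := [set y | _]; have mA : measurable A by exact: measurable_mdist_gt.
have Az : ~ A z by rewrite /A/= mdistxx ltNge (ltW b0).
have mz := measurable_singleton z.
have Qf B : measurable B -> Q z B \is a fin_num.
  move=> mB; rewrite ge0_fin_numE// (le_lt_trans _ (Qfin z))//.
  by apply: le_measure; rewrite ?inE.
pose q := fine (Q z setT); have q0 : 0 <= q by rewrite fine_ge0.
pose a := fine (Q z A); have a0 : 0 <= a by rewrite fine_ge0.
rewrite -(fineK (Qf _ mA)) -/a; congr EFin; apply/eqP.
rewrite eq_le a0 andbT leNgt; apply/negP => {}a0.
have near1 : \forall h \near (0 : R)^'+, a / 2 < fine (transition P X h z A) / h.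
  have := stab z A mA; rewrite -/q -/a indicE memNset// mulr0 subr0.
  move=> /cvgr_gt /(_ (a / 2)) H; have /H : a / 2 < a by lra.
  by apply: filterS => h; rewrite subr0.
have near2 : \forall h \near (0 : R)^'+,
    - (q + 1) < (fine (transition P X h z [set z]) - 1) / h.
  have := stab z [set z] mz; rewrite -/q indicE mem_set// mulr1.
  have : 0 <= fine (Q z [set z]) by rewrite fine_ge0.
  move=> ? /cvgr_gt /(_ (- (q + 1))); apply; lra.
have near0 : \forall h \near (0 : R)^'+, 0 < h by exact: nbhs_right_gt.
(* For small h the probability of leaving z in one step is at most (q + 1) h;
   this choice of t0 makes these probabilities add up to at most 1 / 2. *)
pose t0 := (2 * (q + 1))^-1; have t00 : 0 < t0 by rewrite invr_gt0; lra.
pose E_ (n : nat) := let h := t0 / n.+1%:R in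
  \big[setU/set0]_(k < n.+1) (rests z h k `&` X (h * k%:R + h) @^-1` A).
have h0 (n : nat) : 0 <= t0 / n.+1%:R by rewrite divr_ge0// ltW.
have mE n : measurable (E_ n) by have [] := rests_then_lower_bound n (h0 n) mA Az.
have lower : \forall n \near \oo, ((a * t0 / 4)%:E <= P z (E_ n))%E.
  apply: filterS3 (near_step t00 near0) (near_step t00 near1) (near_step t00 near2).
  move=> n hpos ha hq.
  have [_ H] := rests_then_lower_bound n (h0 n) mA Az.
  rewrite (le_trans _ H)// lee_fin.
  have hN : t0 / n.+1%:R * n.+1%:R = t0 by rewrite divfK.
  move: ha hq hpos hN; set h := t0 / _; set p := fine (transition P X h z [set z]).
  set PA := fine _ => ha hq hpos hN.
  rewrite ltr_pdivlMr// in ha; rewrite ltr_pdivlMr// in hq.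
  have qt0 : (q + 1) * t0 = 2^-1 by rewrite /t0; field; lra.
  have eN : (q + 1) * h * n.+1%:R = 2^-1 by rewrite -mulrA hN.
  have e0 : 0 <= (q + 1) * h by rewrite mulr_ge0//; lra.
  have e1 : (q + 1) * h <= 1.
    have : (q + 1) * h * 1 <= (q + 1) * h * n.+1%:R by rewrite ler_wpM2l// ler1n.
    lra.
  have pn : 2^-1 <= p ^+ n.
    apply: (@le_trans _ _ ((1 - (q + 1) * h) ^+ n)); last first.
      by rewrite lerXn2r// ?nnegrE; lra.
    apply: le_trans (bernoulli_exprn n _); last by rewrite e0.
    rewrite -mulr_natr; move: eN; rewrite -natr1 mulrDr mulr1; lra.
  rewrite -[leRHS]mulr_natr.
  rewrite (_ : a * t0 / 4 = 2^-1 * (a / 2 * h) * n.+1%:R); last first.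
    by rewrite -hN; field.
  rewrite ler_wpM2r// ler_pM//; last exact: ltW.
  by rewrite !mulr_ge0// ltW.
have upper : P z (E_ n) @[n --> \oo] --> 0%E.
  pose f_ n w : \bar R := (\1_(E_ n) w)%:E.
  have mf n : measurable_fun setT (f_ n).
    by apply/measurable_EFinP; exact: measurable_indic.
  have f0 : {ae P z, forall w, setT w -> f_ n w @[n --> \oo] --> 0%E}.
    apply: filterS jumps => w jw _; apply: cvg_near_cst.
    apply: filterS (near_step t00 (jump_path_steps_le (jumpX w) t0 (ltW b0) jw)).
    move=> n steps; rewrite /f_ indicE memNset//.
    rewrite /E_ -(bigcup_mkord _ (fun k => rests z _ k `&` X (_ * k%:R + _) @^-1` A)).
    move=> -[k /= kn [rk]]; rewrite /A/=.
    rewrite -(rk k (leqnn k)) ltNge steps// mulr_ge0//=.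
    rewrite -[leRHS](divfK (x := n.+1%:R))// ler_wpM2l// ler_nat.
    exact: ltnW.
  have f1 : {ae P z, forall w n, setT w -> (`|f_ n w| <= 1)%E}.
    by apply: aeW => w n _; rewrite lee_fin ger0_norm// indicE; case: (_ \in _).
  have int1 := finite_measure_integrable_cst (P z) 1 measurableT.
  have [_ _] := dominated_convergence measurableT mf (measurable_cst _) f0 int1 f1.
  have -> : (fun n => P z (E_ n)) = (fun n => \int[P z]_w f_ n w)%E.
    by apply/funext => n; rewrite integral_indic// setIT.
  by rewrite integral0.
have c0 : (0 < (a * t0 / 4)%:E)%E by rewrite lte_fin !mulr_gt0.
have : ((a * t0 / 4)%:E <= 0)%E by exact: cvge_ge lower upper.
by rewrite leNgt c0.
Qed.

End big_jumps.

(** * Exponential moments over one short time step *)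

Section one_step.
Context (R : realType) (dE dO : measure_display)
        (E : measurableMetricType R dE) (Omega : measurableType dO).
Variables (P : E -> probability Omega R)
          (X : R -> {mfun Omega >-> E}) (Q : R.-ker E ~> E).
Hypothesis borelE : borel_sigma_algebra E.
Hypothesis genQ : has_generator P X Q.
Local Notation T := (semigroup P X).

(** The threshold on h depends on z but not on u: psi(u - u(z)) is dominated by
    a function Psi that involves u only through its Lipschitz constant L and its
    bound M. This uniformity is what allows n different functions u to be
    treated with the same h. *)
Lemma one_step_exp (z : E) (b V L M K : R) : 0 < b -> 0 <= L ->
  Q z [set y | b < mdist z y] = 0%E ->
  (\int[Q z]_y ((mdist z y) ^+ 2)%:E <= (V ^+ 2)%:E)%E ->
  V ^+ 2 / b ^+ 2 * psi (L * b) < K ->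
  \forall h \near 0^'+, forall u, bdd_measurable u -> lipc L u ->
    (forall y, `|u y| <= M) ->
    T h (fun y => expR (u y)) z <= expR (K * h + T h u z).
Proof.
move=> b0 L0 Qb QV KV.
have bpos2 : 0 < b ^+ 2 by rewrite exprn_gt0.
(* The second branch only has to be bounded, because Q z does not charge it;
   2 M bounds the increments of u. *)
pose Psi (y : E) : R := if mdist z y <= b
  then psi (L * b) / b ^+ 2 * mdist z y ^+ 2 else psi (2 * M).
have Psi_z : Psi z = 0 by rewrite /Psi mdistxx ltW// expr0n/= mulr0.
have Psi0 y : 0 <= Psi y.
  rewrite /Psi; case: ifP => _; last exact: psi_ge0.
  by rewrite mulr_ge0 ?sqr_ge0// divr_ge0 ?psi_ge0 ?sqr_ge0.
have md : measurable_fun setT (mdist z).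
  exact: lipc_measurable borelE (lipc_mdist z).
have mPsi : measurable_fun setT Psi.
  apply: measurable_fun_ifT => //.
  - by apply: measurable_fun_ler => //.
  - by apply: measurable_funM => //; exact: measurable_funX.
have bPsi : bdd_measurable Psi.
  split => //; exists (psi (L * b) + psi (2 * M)) => y; rewrite ger0_norm// /Psi.
  case: ifP => yb; last by rewrite lerDr psi_ge0.
  apply: (@le_trans _ _ (psi (L * b))); last by rewrite lerDl psi_ge0.
  rewrite -mulrA ler_piMr ?psi_ge0// mulrC ler_pdivrMr// mul1r.
  by rewrite lerXn2r// ?nnegrE ?mdist_ge0// ltW.
have intPsi : generator Q Psi z <= V ^+ 2 / b ^+ 2 * psi (L * b).
  rewrite /generator /Rintegral Psi_z; under eq_integral do rewrite subr0.
  have k0 : 0 <= psi (L * b) / b ^+ 2 by rewrite divr_ge0 ?psi_ge0 ?ltW.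
  have le : (\int[Q z]_y (Psi y)%:E <=
             (psi (L * b) / b ^+ 2 * V ^+ 2)%:E)%E.
    rewrite EFinM; apply: (@le_trans _ _ ((psi (L * b) / b ^+ 2)%:E *
      \int[Q z]_y ((mdist z y) ^+ 2)%:E)%E); last by rewrite lee_wpmul2l.
    have md2 : measurable_fun setT (fun y => (mdist z y ^+ 2)%:E).
      by apply/measurable_EFinP; exact: measurable_funX.
    rewrite -ge0_integralZl//; last by move=> y _; rewrite lee_fin sqr_ge0.
    apply: ae_ge0_le_integral => //.
    - by move=> y _; rewrite lee_fin.
    - exact/measurable_EFinP.
    - by move=> y _; rewrite mule_ge0// lee_fin// sqr_ge0.
    - exact: measurable_funeM.
    - exists [set y | b < mdist z y]; split => //.
        exact: measurable_mdist_gt.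
      move=> y /= H; rewrite ltNge; apply/negP => yb; apply: H => _.
      by rewrite /Psi yb.
  have Q0 : (0 <= \int[Q z]_y (Psi y)%:E)%E.
    by apply: integral_ge0 => y _; rewrite lee_fin.
  rewrite -lee_fin fineK; last by rewrite ge0_fin_numE// (le_lt_trans le)// ltry.
  by rewrite (le_trans le)// lee_fin; lra.
have := genQ bPsi (x := z); rewrite Psi_z.
move=> /cvgr_lt/(_ _ (le_lt_trans intPsi KV)) near1.
have : \forall h \near (0 : R)^'+, 0 < h by exact: nbhs_right_gt.
apply: filterS2 near1 => h + h0 u bu Lu uM.
rewrite subr0 ltr_pdivrMr// => ThPsi.
(* e^(u y) = e^(u z) (1 + D + psi D) with D = u y - u z. *)
have le y : expR (u y) <= expR (u z) * (Psi y + (1 - u z + u y)).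
  have -> : u y = u z + (u y - u z) by ring.
  rewrite expRD ler_pM2l ?expR_gt0//; set D := u y - u z.
  suff : psi D <= Psi y by rewrite /psi /D; lra.
  rewrite /Psi; case: ifP => yb.
    have Dd : `|D| <= L * mdist z y by rewrite metric_sym; exact: Lu.
    have DLb : `|D| <= L * b by rewrite (le_trans Dd)// ler_wpM2l.
    have [L_eq0|L_neq0] := eqVneq L 0.
      move: Dd; rewrite L_eq0 mul0r normr_le0 => /eqP ->.
      by rewrite psi0 mul0r psi0 !mul0r.
    have Lb2 : 0 < (L * b) ^+ 2 by rewrite exprn_gt0// mulr_gt0// lt_def L_neq0.
    rewrite -(ler_pM2r Lb2) (le_trans (psi_le_sqr DLb))//.
    rewrite [(L * b) ^+ 2 in leRHS]exprMn -[leRHS]mulrA.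
    have -> : psi (L * b) / b ^+ 2 * (mdist z y ^+ 2 * (L ^+ 2 * b ^+ 2)) =
        psi (L * b) * (L * mdist z y) ^+ 2 by field; rewrite gt_eqF.
    rewrite ler_wpM2l ?psi_ge0// -real_normK ?num_real// lerXn2r// nnegrE.
    by rewrite mulr_ge0 ?mdist_ge0.
  apply: psi_le; rewrite (le_trans (ler_normB _ _))//.
  by have := uM y; have := uM z; lra.
have bu1 : bdd_measurable (fun y => (1 - u z) + u y).
  by apply: (bdd_measurableD (f := cst (1 - u z))) => //; exact: bdd_measurable_cst.
apply: le_trans.
  by apply: semigroup_le le; [exact: bdd_measurable_expR|
    apply: bdd_measurableZ; exact: bdd_measurableD].
rewrite semigroupZ; last exact: bdd_measurableD.
rewrite (semigroupD P X h z bPsi bu1).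
have -> : T h (fun y => 1 - u z + u y) z = 1 - u z + T h u z.
  have bc : bdd_measurable (fun _ : E => 1 - u z) by exact: bdd_measurable_cst.
  by rewrite -[in RHS](semigroup_cst P X h (1 - u z) z) -semigroupD.
have -> : K * h + T h u z = u z + (K * h + T h u z - u z) by ring.
rewrite expRD ler_pM2l ?expR_gt0// (le_trans _ (expR_ge1Dx _))//; lra.
Qed.

End one_step.

(** * Dynamic programming along the time grid *)

Section laplace_recursion.
Context (R : realType) (dE dO : measure_display)
        (E : measurableMetricType R dE) (Omega : measurableType dO).
Variables (F : R -> set (set Omega)) (P : E -> probability Omega R)
          (X : R -> {mfun Omega >-> E}).
Hypothesis markovX : markov_process P X F.
Local Notation T := (semigroup P X).

Variables (phi : E -> R).
Hypothesis bphi : bdd_measurable phi.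

(** The expectation of h phi(X_h) + ... + h phi(X_{mh}) as a function of the
    starting point. *)
Fixpoint reward_to_go (h : R) (m : nat) : E -> R :=
  if m is m'.+1 then T h (fun y => h * phi y + reward_to_go h m' y) else fun=> 0.

Definition stage_reward (h : R) (m : nat) (y : E) : R :=
  h * phi y + reward_to_go h m y.

Lemma reward_bdd h m : 0 <= h -> bdd_measurable (reward_to_go h m).
Proof.
move=> h0; elim: m => [|m IH] /=; first exact: bdd_measurable_cst.
apply: (semigroup_bdd markovX) => //.
by apply: bdd_measurableD => //; exact: bdd_measurableZ.
Qed.

Lemma stage_bdd h m : 0 <= h -> bdd_measurable (stage_reward h m).
Proof.
by move=> h0; apply: bdd_measurableD; [exact: bdd_measurableZ|exact: reward_bdd].
Qed.

Lemma reward_norm_le h m N y : 0 <= h -> (forall z, `|phi z| <= N) ->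
  `|reward_to_go h m y| <= h * m%:R * N.
Proof.
move=> h0 phiN; elim: m y => [|m IH] y /=; first by rewrite normr0 mulr0 mul0r.
apply: semigroup_norm_le => [|z]; first exact: (stage_bdd m h0).
rewrite -natr1 mulrDr mulr1 mulrDl addrC (le_trans (ler_normD _ _))// lerD//.
by rewrite normrM ger0_norm// ler_wpM2l.
Qed.

Lemma stage_norm_le h m N y : 0 <= h -> (forall z, `|phi z| <= N) ->
  `|stage_reward h m y| <= h * m.+1%:R * N.
Proof.
move=> h0 phiN; rewrite -natr1 mulrDr mulr1 mulrDl addrC.
rewrite (le_trans (ler_normD _ _))// lerD// ?reward_norm_le//.
by rewrite normrM ger0_norm// ler_wpM2l.
Qed.

Lemma stage_lipc h m a c : 0 <= h -> 0 < a -> 0 <= c -> lipc c phi ->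
  (forall f c, bdd_measurable f -> 0 <= c -> lipc c f ->
     lipc (expR (- (a * h)) * c) (T h f)) ->
  lipc (c * (expR (a * h) / a * (1 - expR (- (a * (h * m.+1%:R))))))
    (stage_reward h m).
Proof.
move=> h0 a0 c0 phic contr.
have C0 k : 0 <= expR (a * h) / a * (1 - expR (- (a * (h * k%:R)))).
  rewrite mulr_ge0 ?divr_ge0 ?expR_ge0 ?(ltW a0)// subr_ge0 -expR0 ler_expR.
  by rewrite oppr_le0 !mulr_ge0// ltW.
elim: m => [|m IH].
  rewrite (_ : stage_reward h 0 = fun y => h * phi y); last first.
    by apply/funext => y; rewrite /stage_reward /= addr0.
  apply: lipc_le (lipcZ h0 phic); rewrite mulrC ler_wpM2l//.
  have := discount_step (h := h) 0 a0 erefl.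
  by rewrite !mulr0 oppr0 expR0 subrr !mulr0 addr0.
apply: lipc_le (lipcD (lipcZ h0 phic) (contr _ _ (stage_bdd m h0) _ IH)).
  rewrite mulrCA [h * c]mulrC -mulrDr ler_wpM2l//.
  exact: discount_step.
by rewrite mulr_ge0.
Qed.

(** Under pi every X_{jh} has law pi, so the expected reward is exact on the
    grid. *)
Lemma reward_stationary (pi : probability E R) h m : stationary P X pi ->
  0 <= h -> \int[pi]_x reward_to_go h m x = h * m%:R * \int[pi]_x phi x.
Proof.
move=> statpi h0; elim: m => [|m IH] /=.
  by rewrite mulr0 mul0r Rintegral_cst// mul0r.
rewrite (stationary_Rintegral markovX statpi h0 (stage_bdd m h0)).
rewrite RintegralD//; last 2 first.
- by apply: bdd_measurable_integrable; exact: bdd_measurableZ.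
- by apply: bdd_measurable_integrable; exact: reward_bdd.
rewrite IH RintegralZl//; last exact: bdd_measurable_integrable.
by rewrite -natr1; ring.
Qed.

Section forward_induction.
Variables (x : E) (l h K : R) (n : nat) (A : set E).
Hypotheses (h0 : 0 <= h) (mA : measurable A).
Hypothesis good : forall z m, A z -> (m < n)%N ->
  T h (fun y => expR (l * stage_reward h m y)) z <=
  expR (K * h + l * reward_to_go h m.+1 z).

(** The exponential of the reward collected until time h k, restricted to the
    trajectories that were in A at the times 0, h, ..., h (k - 1). *)
Definition path_weight (k : nat) (w : Omega) : R :=
  \prod_(j < k) (\1_A (X (h * j%:R) w) *
    expR (l * (h * phi (X (h * j.+1%:R) w)))).

Lemma path_weight_ge0 k w : 0 <= path_weight k w.
Proof. by apply: prodr_ge0 => j _; rewrite mulr_ge0 ?expR_ge0// indicE. Qed.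

Lemma measurable_path_weight (s : R) k : h * k%:R <= s ->
  measurable_fun setT (path_weight k : g_sigma_algebraType (F s) -> R).
Proof.
move=> ks; apply: measurable_prod => j _; apply: measurable_funM.
  apply: (measurable_at markovX (f := \1_A)); rewrite ?mulr_ge0//.
    by rewrite (le_trans _ ks)// ler_wpM2l// ler_nat ltnW.
apply: (measurable_at markovX (f := fun y => expR (l * (h * phi y)))).
- by rewrite mulr_ge0.
- by rewrite (le_trans _ ks)// ler_wpM2l// ler_nat.
apply: measurableT_comp => //; apply: measurable_funM => //.
by apply: measurable_funM => //; case: bphi.
Qed.

(** Forward induction on k: the expectation of
    path_weight k * exp(l U_{n-k}(X_{hk})) grows at most by a factor e^(K h) at
    each step. The Markov property at time h k needs the state at that time to
    lie in A; dropping this constraint afterwards only increases the integral. *)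
Lemma path_weight_laplace :
  (\int[P x]_w (path_weight n w)%:E <=
   (expR (K * (h * n%:R) + l * reward_to_go h n x))%:E)%E.
Proof.
have hk0 k : 0 <= h * k%:R by rewrite mulr_ge0.
have hS k : h * k%:R + h = h * k.+1%:R by rewrite -natr1 mulrDr mulr1.
have bW m : bdd_measurable (fun y => expR (l * stage_reward h m y)).
  by apply: bdd_measurable_expR; apply: bdd_measurableZ; exact: stage_bdd.
have bV m : bdd_measurable (fun y => expR (l * reward_to_go h m y)).
  by apply: bdd_measurable_expR; apply: bdd_measurableZ; exact: reward_bdd.
have step k : (k <= n)%N ->
  (\int[P x]_w (path_weight k w *
      expR (l * reward_to_go h (n - k) (X (h * k%:R) w)))%:E
   <= (expR (K * (h * k%:R) + l * reward_to_go h n x))%:E)%E.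
  elim: k => [_|k IH kn].
    rewrite subn0 !mulr0 add0r.
    under eq_integral do rewrite /path_weight big_ord0 mul1r.
    by rewrite (expectation0 markovX x (bV n) (fun y => expR_ge0 _)).
  have {}IH := IH (ltnW kn).
  pose Z w := path_weight k w * \1_A (X (h * k%:R) w).
  have Z0 w : 0 <= Z w by rewrite mulr_ge0 ?path_weight_ge0// indicE.
  have mZ : measurable_fun setT (Z : g_sigma_algebraType (F (h * k%:R)) -> R).
    apply: measurable_funM; first exact: measurable_path_weight.
    by apply: (measurable_at markovX (f := \1_A)).
  pose m := (n - k.+1)%N.
  have mE : (n - k)%N = m.+1 by rewrite /m subnS prednK// subn_gt0.
  rewrite (eq_integral (fun w =>
    (Z w * expR (l * stage_reward h m (X (h * k%:R + h) w)))%:E)); last first.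
    move=> w _; rewrite /path_weight big_ord_recr/= hS /Z -!mulrA.
    congr (_ * (_ * _))%:E.
    by rewrite -expRD -mulrDr.
  rewrite (markov_integral markovX x (hk0 k) h0 (bW m)
    (fun y => expR_ge0 _) Z0 mZ).
  have bT := semigroup_bdd markovX h0 (bW m).
  have meas f : bdd_measurable f ->
      measurable_fun setT (fun w => (Z w * f (X (h * k%:R) w))%:E).
    move=> [mf _]; apply/measurable_EFinP; apply: measurable_funM.
      exact: (filtration_measurable markovX (hk0 k) mZ).
    exact: measurableT_comp.
  have mVk : measurable_fun setT (fun w => (path_weight k w *
      expR (l * reward_to_go h (n - k) (X (h * k%:R) w)))%:E).
    apply/measurable_EFinP; apply: measurable_funM.
      apply: (filtration_measurable markovX (hk0 k)); exact: measurable_path_weight.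
    apply: (measurableT_comp
      (f := fun y => expR (l * reward_to_go h (n - k) y))) => //.
    by case: (bV (n - k)%N).
  apply: (@le_trans _ _ (\int[P x]_w ((expR (K * h))%:E *
      (path_weight k w *
       expR (l * reward_to_go h (n - k) (X (h * k%:R) w)))%:E))%E).
    apply: ge0_le_integral => //.
    - move=> w _; rewrite lee_fin mulr_ge0//.
      rewrite -(semigroup_cst P X h 0 (X (h * k%:R) w)).
      apply: semigroup_le; [exact: bdd_measurable_cst|exact: bW|].
      by move=> y; exact: expR_ge0.
    - exact: meas.
    - by apply: measurable_funeM; exact: mVk.
    - move=> w _; rewrite -EFinM lee_fin /Z indicE.
      have [wA|wA] := boolP (X (h * k%:R) w \in A); last first.
        by rewrite mulr0 mul0r !mulr_ge0 ?expR_ge0 ?path_weight_ge0.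
      rewrite mulr1 mE mulrCA -expRD ler_wpM2l ?path_weight_ge0//.
      by apply: good; [rewrite inE in wA|rewrite -mE leq_subr].
  rewrite ge0_integralZl//; last first.
    by move=> w _; rewrite lee_fin mulr_ge0 ?path_weight_ge0 ?expR_ge0.
  apply: le_trans (lee_wpmul2l _ IH) _; first by rewrite lee_fin expR_ge0.
  rewrite -EFinM lee_fin -expRD ler_expR addrA lerD2r.
  by rewrite -mulrDr addrC hS.
have := step n (leqnn n); rewrite subnn /=; apply: le_trans.
rewrite le_eqVlt; apply/orP; left; apply/eqP; apply: eq_integral => w _.
by rewrite mulr0 expR0 mulr1.
Qed.

End forward_induction.

End laplace_recursion.

(** * The exponential moment of the time integral *)

Lemma fatou_le d (T : measurableType d) (R : realType)
    (mu : {measure set T -> \bar R}) (Y : nat -> T -> R) (f : T -> R)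
    (C : \bar R) :
  (forall n, measurable_fun setT (Y n)) -> (forall n x, 0 <= Y n x) ->
  (forall x, Y n x @[n --> \oo] --> f x) ->
  (\forall n \near \oo, (\int[mu]_x (Y n x)%:E <= C)%E) ->
  (\int[mu]_x (f x)%:E <= C)%E.
Proof.
move=> mY Y0 Yf YC.
have mEY n : measurable_fun setT (EFin \o Y n) by exact/measurable_EFinP.
have EY0 n x : setT x -> (0 <= (EFin \o Y n) x)%E by move=> _; rewrite lee_fin.
have := fatou mu measurableT mEY EY0.
rewrite (eq_integral (EFin \o f)); last first.
  move=> x _; have fx : (Y n x)%:E @[n --> \oo] --> (f x)%:E.
    by apply: cvg_EFin; [exact: nearW|exact: Yf].
  by have [-> _] := cvg_limn_einf_sup fx.
move/le_trans; apply; rewrite limn_einf_lim.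
apply: lime_le; first exact: is_cvg_einfs.
apply: filterS YC => n; apply: le_trans.
by apply: ereal_inf_lbound; exists n => /=.
Qed.

Section additive_functional.
Context (R : realType) (dE dO : measure_display)
        (E : measurableMetricType R dE) (Omega : measurableType dO).
Variables (X : R -> {mfun Omega >-> E}).
Hypothesis jumpX : forall w, jump_path (X ^~ w).

Definition time_integral (phi : E -> R) (t : R) (w : Omega) : R :=
  \int[lebesgue_measure]_(s in `[0, t]) phi (X s w).

Lemma cvg_riemann_time_integral phi M t w : 0 < t ->
  (forall y, `|phi y| <= M) ->
  riemann_sum (fun s => phi (X s w)) t n @[n --> \oo] --> time_integral phi t w.
Proof.
move=> t0 phiM; apply: cvg_riemann_sum => // s s0.
have [/(_ s s0) + _] := jumpX w.
by apply: filterS => s' ->.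
Qed.

Lemma measurable_riemann_sum phi t n : measurable_fun setT phi ->
  measurable_fun setT (fun w => riemann_sum (fun s => phi (X s w)) t n).
Proof.
move=> mphi; apply: measurable_funM => //.
by apply: measurable_sum => k; exact: measurableT_comp.
Qed.

End additive_functional.

Section first_moment.
Context (R : realType) (dE : measure_display) (E : measurableMetricType R dE).
Variables (pi : probability E R).
Hypothesis borelE : borel_sigma_algebra E.
Hypothesis momentpi : finite_first_moment pi.

Lemma mdist_integrable x : pi.-integrable setT (EFin \o mdist x).
Proof.
have [x0 fin] := momentpi.
have md (z : E) : measurable_fun [set: E] (EFin \o mdist z).
  by apply/measurable_EFinP; exact: (lipc_measurable borelE (lipc_mdist z)).
have int0 : pi.-integrable setT (EFin \o mdist x0).
  apply/integrableP; split => //.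
  under eq_integral do rewrite /= ger0_norm ?mdist_ge0//.
  exact: fin.
apply: (le_integrable measurableT (md x)
  (g := (EFin \o (fun=> mdist x x0)) \+ (EFin \o mdist x0))%E).
  move=> y _ /=; rewrite !lee_fin !ger0_norm ?addr_ge0 ?mdist_ge0//.
  exact: metric_triangle.
apply: integrableD => //; exact: finite_measure_integrable_cst.
Qed.

Lemma lipc_integrable c f : lipc c f -> pi.-integrable setT (EFin \o f).
Proof.
move=> fc; have x0 : E := point.
have mf : measurable_fun [set: E] (EFin \o f).
  by apply/measurable_EFinP; exact: (lipc_measurable borelE fc).
pose G (y : E) : \bar R := ((`|f x0|)%:E + c%:E * (mdist x0 y)%:E)%E.
apply: (@le_integrable _ _ _ pi setT measurableT (EFin \o f) G mf).
- move=> y _; rewrite /G -EFinM -EFinD /= lee_fin [leRHS]ger0_norm; last first.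
    by rewrite addr_ge0// (le_trans _ (fc x0 y)).
  rewrite -lerBlDl (le_trans _ (fc x0 y))// distrC.
  exact: lerB_dist.
- apply: integrableD => //; first exact: finite_measure_integrable_cst.
  by apply: integrableZl => //; exact: mdist_integrable.
Qed.

(** Averaging f x <= f z + c d(x, z) over z distributed as pi; this is where
    the bias comes from. *)
Lemma lipc_centered x c f : lipc c f ->
  f x <= \int[pi]_z f z + c * \int[pi]_z mdist x z.
Proof.
move=> fc; rewrite -RintegralZl//; last exact: mdist_integrable.
have Ic : pi.-integrable setT (EFin \o (fun z => c * mdist x z)).
  by apply: (integrableZl measurableT c (mdist_integrable x)).
rewrite -RintegralD//; last exact: lipc_integrable fc.
have -> : f x = \int[pi]_z (cst (f x)) z.
  by rewrite Rintegral_cst// [X in fine X]probability_setT mulr1.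
apply: le_Rintegral => //.
- exact: finite_measure_integrable_cst.
- exact: (integrableD measurableT (lipc_integrable fc) Ic).
- move=> z _ /=; have := fc x z; rewrite ler_norml => /andP[]; lra.
Qed.

End first_moment.

Section laplace.
Context (R : realType) (dE dO : measure_display)
        (E : measurableMetricType R dE) (Omega : measurableType dO).
Variables (F : R -> set (set Omega)) (P : E -> probability Omega R)
          (X : R -> {mfun Omega >-> E}) (Q : R.-ker E ~> E)
          (sigma b V : R) (pi : probability E R).
Hypothesis borelE : borel_sigma_algebra E.
Hypothesis jumpX : cadlag_markov_jump_process P X F Q.
Hypothesis curvature : is_wasserstein_curvature P X sigma.
Hypotheses (sigma_gt0 : 0 < sigma) (b_gt0 : 0 < b).
Hypothesis jump_le : forall x, {ae P x, forall w, forall t, 0 < t ->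
  mdist (left_lim (X ^~ w) t) (X t w) <= b}.
Hypothesis variance_le :
  (ereal_sup [set \int[Q x]_y ((mdist x y) ^+ 2)%:E | x in [set: E]]
   <= (V ^+ 2)%:E)%E.
Hypothesis momentpi : finite_first_moment pi.
Hypothesis stationarypi : stationary P X pi.
Local Notation T := (semigroup P X).

Variables (phi : E -> R) (M L t l : R).
Hypotheses (phiM : forall y, `|phi y| <= M) (phiL : lipc L phi).
Hypotheses (L_ge0 : 0 <= L) (t_gt0 : 0 < t) (l_gt0 : 0 < l).
Let c := (1 - expR (- (sigma * t))) * L / sigma.
Let bphi : bdd_measurable phi.
Proof. by split; [exact: (lipc_measurable borelE phiL)|exists M]. Qed.

(** The factor kappa > 1 pays for two losses on a grid of positive step: the
    contraction rate a = sigma / kappa instead of sigma, and the factor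
    e^(a h) <= kappa in the bound of the discrete Lipschitz constants. *)
Lemma laplace_dilated (kappa K : R) x : 1 < kappa ->
  V ^+ 2 / b ^+ 2 * psi (l * (kappa ^+ 2 * c) * b) < K ->
  (\int[P x]_w (expR (l * time_integral X phi t w))%:E <=
   (expR (K * t + l * (t * \int[pi]_z phi z +
                       kappa ^+ 2 * c * \int[pi]_z mdist x z)))%:E)%E.
Proof.
move=> kappa1 KV; have [markovX _ jumps stableQ genQ] := jumpX.
have kappa0 : 0 < kappa by lra.
have c0 : 0 <= c.
  rewrite /c divr_ge0 ?(ltW sigma_gt0)// mulr_ge0// subr_ge0 -expR0 ler_expR.
  by rewrite oppr_le0 mulr_ge0// ltW.
pose a := sigma / kappa; have a0 : 0 < a by rewrite divr_gt0.
have asigma : a < sigma by rewrite ltr_pdivrMr// ltr_pMr.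
pose h n : R := t / n.+1%:R.
have h0 n : 0 <= h n by rewrite divr_ge0// ltW.
have hN n : h n * n.+1%:R = t by rewrite divfK.
pose L' := kappa ^+ 2 * c.
have L'0 : 0 <= L' by rewrite mulr_ge0// sqr_ge0.
have small : \forall n \near \oo, expR (a * h n) <= kappa /\
  (forall f c, bdd_measurable f -> 0 <= c -> lipc c f ->
     lipc (expR (- (a * h n)) * c) (T (h n) f)).
  apply: filterI; last exact: near_step (curvature_contraction curvature asigma).
  have d0 : 0 < ln kappa / a by rewrite divr_gt0// ln_gt0.
  apply: filterS (near_step t_gt0 (nbhs_right_lt d0)) => n hn.
  by rewrite -[leRHS]lnK ?posrE// ler_expR mulrC -ler_pdivlMr// ltW.
have lipW : \forall n \near \oo, forall m, (m < n.+1)%N ->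
    lipc L' (stage_reward P X phi (h n) m).
  apply: filterS small => n [expk contr] m mn.
  apply: lipc_le (stage_lipc markovX bphi m (h0 n) a0 L_ge0 phiL contr).
  rewrite /L'.
  rewrite (_ : _ * c = L * (kappa / a * (1 - expR (- (sigma * t))))); last first.
    by rewrite /c /a; field; rewrite !gt_eqF.
  apply: ler_wpM2l => //; apply: ler_pM.
  - by rewrite divr_ge0 ?expR_ge0 ?ltW.
  - rewrite subr_ge0 -expR0 ler_expR oppr_le0 mulr_ge0 ?(ltW a0)//.
    by rewrite mulr_ge0.
  - by rewrite ler_pM2r// invr_gt0.
  - rewrite lerD2l lerN2 ler_expR lerN2 -[X in sigma * X](hN n).
    apply: ler_pM; [exact: ltW a0|by rewrite mulr_ge0|exact: ltW asigma|].
    by rewrite ler_wpM2l// ler_nat.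
pose B n (z : E) := forall m, (m < n.+1)%N ->
  T (h n) (fun y => expR (l * stage_reward P X phi (h n) m y)) z <=
  expR (K * h n + l * reward_to_go P X phi (h n) m.+1 z).
have nearB z : \forall n \near \oo, B n z.
  have Qb := kernel_no_big_jump borelE markovX jumps stableQ b_gt0 (jump_le z).
  have QV : (\int[Q z]_y ((mdist z y) ^+ 2)%:E <= (V ^+ 2)%:E)%E.
    by rewrite (le_trans _ variance_le)//; apply: ereal_sup_ubound; exists z.
  have KV' : V ^+ 2 / b ^+ 2 * psi (l * L' * b) < K by [].
  have lL'0 : 0 <= l * L' by rewrite mulr_ge0// ltW.
  have := near_step t_gt0
    (one_step_exp borelE genQ (l * (t * M)) b_gt0 lL'0 Qb QV KV').
  apply: filterS2 lipW => n lipWn stepn m mn.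
  have := stepn (fun y => l * stage_reward P X phi (h n) m y).
  have bS := stage_bdd markovX bphi m (h0 n).
  rewrite semigroupZ//.
  apply.
  - exact: bdd_measurableZ.
  - by apply: lipcZ; [exact: ltW|exact: lipWn].
  - move=> y; rewrite normrM gtr0_norm// ler_wpM2l ?(ltW l_gt0)//.
    rewrite (le_trans (stage_norm_le markovX bphi m y (h0 n) phiM))//.
    apply: ler_wpM2r; first exact: le_trans (normr_ge0 _) (phiM y).
    by rewrite -[leRHS](hN n) ler_wpM2l// ler_nat.
have mB n : measurable (B n).
  pose Bm m := [set z |
    T (h n) (fun y => expR (l * stage_reward P X phi (h n) m y)) z <=
    expR (K * h n + l * reward_to_go P X phi (h n) m.+1 z)].
  rewrite (_ : B n = \bigcap_(m in [set m | (m < n.+1)%N]) Bm m)//.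
  apply: bigcap_measurableType => m _; rewrite -[Bm m]setTI.
  apply: measurable_fun_le => //.
    have := bdd_measurable_expR
      (bdd_measurableZ l (stage_bdd markovX bphi m (h0 n))).
    by move=> /(semigroup_bdd markovX (h0 n))[].
  apply: measurableT_comp => //; apply: measurable_funD => //.
  by apply: measurable_funM => //; have [] := reward_bdd markovX bphi m.+1 (h0 n).
pose Y n w := path_weight X phi l (h n) (B n) n.+1 w.
have Ycvg w : Y n w @[n --> \oo] --> expR (l * time_integral X phi t w).
  have EY : \forall n \near \oo,
      expR (l * riemann_sum (fun s => phi (X s w)) t n) = Y n w.
    apply: filterS (jump_path_near_range (jumps w) t nearB) => n Bn.
    rewrite /Y /path_weight /riemann_sum mulr_sumr mulr_sumr expR_sum.
    apply: eq_bigr => k _; rewrite indicE mem_set ?mul1r//; apply: Bn.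
    rewrite mulr_ge0//= -[leRHS](hN n) ler_wpM2l// ler_nat; exact: ltnW.
  apply: cvg_trans (near_eq_cvg EY) _.
  apply: (continuous_cvg _ (@continuous_expR R _)).
  by apply: cvgMl_tmp; exact: cvg_riemann_time_integral phiM.
have Yle : \forall n \near \oo, (\int[P x]_w (Y n w)%:E <=
   (expR (K * t + l * (t * \int[pi]_z phi z + L' * \int[pi]_z mdist x z)))%:E)%E.
  apply: filterS2 small lipW => n [_ contr] lipWn.
  apply: le_trans (path_weight_laplace markovX bphi x (h0 n) (mB n) _) _.
    by move=> z m Bz mn; exact: Bz.
  rewrite lee_fin ler_expR hN lerD2l ler_wpM2l ?(ltW l_gt0)//.
  have lipR : lipc L' (reward_to_go P X phi (h n) n.+1).
    apply: lipc_le
      (contr _ _ (stage_bdd markovX bphi n (h0 n)) L'0 (lipWn n (ltnSn n))).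
    rewrite ler_piMl// -[leRHS]expR0 ler_expR oppr_le0 mulr_ge0//; exact: ltW.
  rewrite (le_trans (lipc_centered borelE momentpi x lipR))// lerD2r.
  by rewrite (reward_stationary markovX bphi n.+1 stationarypi (h0 n)) hN.
apply: fatou_le Yle => //.
- move=> n; apply: (filtration_measurable markovX (ltW t_gt0)).
  by apply: (measurable_path_weight markovX bphi); rewrite ?hN.
- by move=> n w; exact: path_weight_ge0.
Qed.

End laplace.

(** * Truncation *)

Section truncation.
Context (R : realType) (dE dO : measure_display)
        (E : measurableMetricType R dE) (Omega : measurableType dO).
Variables (X : R -> {mfun Omega >-> E}).
Hypothesis jumpX : forall w, jump_path (X ^~ w).
Variables (phi : E -> R).
Hypothesis mphi : measurable_fun setT phi.

Definition truncation (N : nat) (y : E) : R :=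
  Num.max (- N%:R) (Num.min N%:R (phi y)).

Lemma truncation_le N y : `|truncation N y| <= N%:R.
Proof.
have N0 : 0 <= N%:R :> R by [].
by rewrite ler_norml le_max lexx/= ge_max ge_min lexx/= andbT; lra.
Qed.

Lemma truncation_norm_le N y : `|truncation N y| <= `|phi y|.
Proof.
rewrite /truncation /Num.max /Num.min; have N0 : 0 <= N%:R :> R by [].
by have [?|?] := ltP N%:R (phi y); case: ltP => ?;
  rewrite ler_norml; have := ler_norm (phi y); have := ler_norm (- phi y);
  rewrite normrN => ? ?; apply/andP; split; lra.
Qed.

Lemma truncation_id N y : `|phi y| <= N%:R -> truncation N y = phi y.
Proof.
by rewrite ler_norml => /andP[? ?]; rewrite /truncation min_r// max_r.
Qed.

Lemma truncation_bdd N : bdd_measurable (truncation N).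
Proof.
split; last by exists N%:R; exact: truncation_le.
by apply: measurable_maxr => //; exact: measurable_minr.
Qed.

Lemma near_truncation_id t w : \forall N \near \oo,
  forall s, 0 <= s <= t -> truncation N (X s w) = phi (X s w).
Proof.
have near_z z : \forall N \near \oo, `|phi z| <= N%:R by exact: nbhs_infty_ger.
apply: filterS (jump_path_near_range (jumpX w) t near_z) => N HN s /HN.
exact: truncation_id.
Qed.

Lemma near_time_integral_truncation t w : \forall N \near \oo,
  time_integral X (truncation N) t w = time_integral X phi t w.
Proof.
apply: filterS (near_truncation_id t w) => N HN.
by apply: eq_Rintegral => s; rewrite inE/= in_itv/= => /HN.
Qed.

Lemma cvg_riemann_path t w : 0 < t ->
  riemann_sum (fun s => phi (X s w)) t n @[n --> \oo] --> time_integral X phi t w.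
Proof.
move=> t0; have [N _ HN] := near_truncation_id t w.
have {}HN := HN N (leqnn N).
have -> : time_integral X phi t w = time_integral X (truncation N) t w.
  by apply: eq_Rintegral => s; rewrite inE/= in_itv/= => /HN.
rewrite (_ : riemann_sum _ t = riemann_sum (fun s => truncation N (X s w)) t).
  exact: (cvg_riemann_time_integral jumpX t0 (truncation_le N)).
apply/funext => n; rewrite /riemann_sum; congr (_ * _); apply: eq_bigr => k _.
rewrite HN// mulr_ge0 ?divr_ge0 ?(ltW t0)//=.
rewrite -[leRHS](divfK (x := n.+1%:R))// ler_wpM2l ?divr_ge0 ?(ltW t0)//.
by rewrite ler_nat.
Qed.

Lemma measurable_time_integral t : 0 < t ->
  measurable_fun setT (time_integral X phi t).
Proof.
move=> t0.
apply: (measurable_fun_cvg (h := fun n w => riemann_sum (fun s => phi (X s w)) t n)).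
  by move=> n; exact: measurable_riemann_sum.
by move=> w _; exact: cvg_riemann_path.
Qed.

End truncation.

Lemma time_integralN (R : realType) (dE dO : measure_display)
    (E : measurableMetricType R dE) (Omega : measurableType dO)
    (X : R -> {mfun Omega >-> E}) (phi : E -> R) t w :
  (forall w, jump_path (X ^~ w)) -> 0 < t ->
  time_integral X (\- phi) t w = - time_integral X phi t w.
Proof.
move=> jumpX t0.
have H : riemann_sum (fun s => (\- phi) (X s w)) t n @[n --> \oo] -->
    - time_integral X phi t w.
  rewrite (_ : riemann_sum _ t = \- riemann_sum (fun s => phi (X s w)) t).
    by apply: cvgN; exact: cvg_riemann_path.
  by apply/funext => n; rewrite /riemann_sum /= sumrN mulrN.
have H' := cvg_riemann_path (phi := \- phi) (w := w) jumpX t0.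
exact: (cvg_unique (@norm_hausdorff _ _) H' H).
Qed.

(** * Tail bounds *)

Section tail.
Context (R : realType) (dE dO : measure_display)
        (E : measurableMetricType R dE) (Omega : measurableType dO).
Variables (F : R -> set (set Omega)) (P : E -> probability Omega R)
          (X : R -> {mfun Omega >-> E}) (Q : R.-ker E ~> E)
          (sigma b V : R) (pi : probability E R).
Hypothesis borelE : borel_sigma_algebra E.
Hypothesis jumpX : cadlag_markov_jump_process P X F Q.
Hypothesis curvature : is_wasserstein_curvature P X sigma.
Hypotheses (sigma_gt0 : 0 < sigma) (b_gt0 : 0 < b) (V_gt0 : 0 < V).
Hypothesis jump_le : forall x, {ae P x, forall w, forall t, 0 < t ->
  mdist (left_lim (X ^~ w) t) (X t w) <= b}.
Hypothesis variance_le :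
  (ereal_sup [set \int[Q x]_y ((mdist x y) ^+ 2)%:E | x in [set: E]]
   <= (V ^+ 2)%:E)%E.
Hypothesis momentpi : finite_first_moment pi.
Hypothesis stationarypi : stationary P X pi.
Variables (L t : R).
Hypotheses (L_ge0 : 0 <= L) (t_gt0 : 0 < t).
Local Notation c := ((1 - expR (- (sigma * t))) * L / sigma).
Let jumps : forall w, jump_path (X ^~ w).
Proof. by have [] := jumpX. Qed.

(** The limit kappa -> 1+ of the dilated bound, along K exceeding its lower
    limit by kappa - 1. *)
Lemma laplace_bdd (phi : E -> R) M l x :
  (forall y, `|phi y| <= M) -> lipc L phi -> 0 < l ->
  (\int[P x]_w (expR (l * time_integral X phi t w))%:E <=
   (expR (t * (V ^+ 2 / b ^+ 2 * psi (l * c * b)) +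
          l * (t * \int[pi]_z phi z + c * \int[pi]_z mdist x z)))%:E)%E.
Proof.
move=> phiM phiL l0.
(* G is continuous, and G 1 is the bound to be proved. *)
pose G (kappa : R) := expR ((V ^+ 2 / b ^+ 2 * psi (l * (kappa ^+ 2 * c) * b) +
    (kappa - 1)) * t +
    l * (t * \int[pi]_z phi z + kappa ^+ 2 * c * \int[pi]_z mdist x z)).
have G1 : G 1 = expR (t * (V ^+ 2 / b ^+ 2 * psi (l * c * b)) +
    l * (t * \int[pi]_z phi z + c * \int[pi]_z mdist x z)).
  by rewrite /G expr1n !mul1r subrr addr0 [in RHS](mulrC t (_ * psi _)).
rewrite -G1.
have Gle : \forall kappa \near (1 : R)^'+,
    (\int[P x]_w (expR (l * time_integral X phi t w))%:E <= (G kappa)%:E)%E.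
  apply: filterS (nbhs_right_gt (1 : R)) => kappa kappa1.
  apply: (laplace_dilated borelE jumpX curvature sigma_gt0 b_gt0 jump_le
    variance_le momentpi stationarypi phiM phiL L_ge0 t_gt0 l0 x kappa1).
  by rewrite ltrDl subr_gt0.
apply: cvge_ge Gle _; apply: cvg_EFin; first exact: nearW.
rewrite /comp /=; apply: cvg_at_right_filter.
apply: (continuous_cvg _ (@continuous_expR R _)).
have sq : k ^+ 2 @[k --> (1 : R)] --> (1 : R) ^+ 2.
  exact: exprn_continuous.
apply: cvgD; last first.
  apply: cvgMl_tmp; apply: cvgD; first exact: cvg_cst.
  by apply: cvgMr_tmp; exact: cvgMr_tmp.
apply: cvgMr_tmp; apply: cvgD; last by apply: cvgB; [exact: cvg_id|exact: cvg_cst].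
apply: cvgMl_tmp; apply: (continuous_cvg _ (@continuous_psi R _)).
by apply: cvgMr_tmp; apply: cvgMl_tmp; exact: cvgMr_tmp.
Qed.

(** Centering by t pi(phi) makes the right-hand side independent of the
    truncation level, so that Fatou's lemma applies. *)
Lemma laplace_lip (phi : E -> R) l x : lipc L phi -> 0 < l ->
  (\int[P x]_w (expR (l * (time_integral X phi t w - t * \int[pi]_z phi z)))%:E <=
   (expR (t * (V ^+ 2 / b ^+ 2 * psi (l * c * b)) +
          l * c * \int[pi]_z mdist x z))%:E)%E.
Proof.
move=> phiL l0; have mphi := lipc_measurable borelE phiL.
have tL N : lipc L (truncation phi N) by apply: lipc_max; exact: lipc_min.
have cvg_pi : \int[pi]_z truncation phi N z @[N --> \oo] --> \int[pi]_z phi z.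
  have intphi : pi.-integrable setT (EFin \o phi).
    exact: (lipc_integrable borelE momentpi phiL).
  apply: fine_cvg; rewrite fineK; last exact: integrable_fin_num.
  have mt N : measurable_fun setT (EFin \o truncation phi N).
    by apply/measurable_EFinP; case: (truncation_bdd mphi N).
  have cvg_t : {ae pi, forall z, setT z ->
      (EFin \o truncation phi N) z @[N --> \oo] --> (EFin \o phi) z}.
    apply: aeW => z _; apply: cvg_near_cst.
    apply: filterS (nbhs_infty_ger `|phi z|) => N zN.
    by rewrite /= truncation_id.
  have dom : {ae pi, forall z N, setT z ->
      (`|(EFin \o truncation phi N) z| <= (abse \o (EFin \o phi)) z)%E}.
    by apply: aeW => z N _; rewrite lee_fin truncation_norm_le.
  by have [] := dominated_convergence measurableT mt (measurable_int _ intphi)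
    cvg_t (integrable_abse intphi) dom.
pose Y N w := expR (l * (time_integral X (truncation phi N) t w -
                         t * \int[pi]_z truncation phi N z)).
have mI N : measurable_fun setT (time_integral X (truncation phi N) t).
  apply: measurable_time_integral => //.
  by case: (truncation_bdd mphi N).
apply: (fatou_le (Y := Y)).
- by move=> N; apply: measurableT_comp => //; apply: measurable_funM => //;
    apply: measurable_funB.
- by move=> N w; exact: expR_ge0.
- move=> w; apply: (continuous_cvg _ (@continuous_expR R _)); apply: cvgMl_tmp.
  apply: cvgB; last exact: cvgMl_tmp.
  by apply: cvg_near_cst; exact: near_time_integral_truncation.
apply: nearW => N; set p := \int[pi]_z truncation phi N z.
have -> : (fun w => (Y N w)%:E) = (fun w => (expR (- (l * (t * p))))%:E *
    (expR (l * time_integral X (truncation phi N) t w))%:E)%E.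
  by apply/funext => w; rewrite /Y -EFinM -expRD -/p mulrBr addrC.
rewrite ge0_integralZl//; last first.
  apply/measurable_EFinP; apply: measurableT_comp => //.
  exact: measurable_funM.
apply: (le_trans (lee_wpmul2l _ (laplace_bdd x (truncation_le phi N) (tL N) l0))).
  by rewrite lee_fin expR_ge0.
rewrite -EFinM -expRD lee_fin ler_expR -/p; lra.
Qed.

Lemma upper_tail (phi : E -> R) x y : lipc L phi -> 0 < L -> 0 < y ->
  (P x [set w | t * y + c * \int[pi]_z mdist x z <=
                time_integral X phi t w - t * \int[pi]_z phi z]%R <=
   (expR (- (V ^+ 2 * t / b ^+ 2 * g (b * y / (V ^+ 2 * c)))))%:E)%E.
Proof.
move=> phiL L0 y0.
have c0 : 0 < c.
  rewrite divr_gt0// mulr_gt0// subr_gt0 -expR0 ltr_expR oppr_lt0 mulr_gt0//.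
pose u := b * y / (V ^+ 2 * c); have u0 : 0 < u.
  by apply: divr_gt0; apply: mulr_gt0 => //; exact: exprn_gt0.
pose l := ln (1 + u) / (c * b); have l0 : 0 < l.
  by apply: divr_gt0; [apply: ln_gt0; rewrite ltrDl|exact: mulr_gt0].
have mJ : measurable_fun setT
    (fun w => time_integral X phi t w - t * \int[pi]_z phi z).
  apply: measurable_funB => //; apply: measurable_time_integral => //.
  exact: lipc_measurable phiL.
pose J := mfun_Sub (mem_set mJ : (fun w => _) \in mfun).
have := @chernoff _ _ _ (P x) J l (t * y + c * \int[pi]_z mdist x z) l0.
move=> /= /le_trans; apply.
rewrite /mmt_gen_fun unlock.
apply: (@le_trans _ _ ((expR (t * (V ^+ 2 / b ^+ 2 * psi (l * c * b)) +
    l * c * \int[pi]_z mdist x z))%:E *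
    (expR (- (l * (t * y + c * \int[pi]_z mdist x z))))%:E)%E).
  apply: lee_wpmul2r; first by rewrite lee_fin expR_ge0.
  have := laplace_lip x phiL l0; apply: le_trans.
  rewrite le_eqVlt; apply/orP; left; apply/eqP; apply: eq_integral => w _ /=.
  by rewrite mulrC.
rewrite -EFinM -expRD lee_fin ler_expR -(cramer_exponent t b_gt0 V_gt0 c0 y0).
rewrite -/u -/l; lra.
Qed.

End tail.

(** * The deviation inequality *)

Lemma bias_cvg0 (R : realType) dE (E : measurableMetricType R dE) (sigma : R)
    (pi : probability E R) (phi : E -> R) x : 0 < sigma ->
  bias sigma pi phi x t @[t --> +oo] --> (0 : R).
Proof.
move=> s0; set L := fine (lip_norm phi); set m := \int[pi]_z mdist x z.
have L0 : 0 <= L by rewrite fine_ge0 ?lip_norm_ge0.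
have m0 : 0 <= m by apply: Rintegral_ge0 => z _; exact: mdist_ge0.
have lim0 : (L * m / sigma) * t^-1 @[t --> +oo] --> (L * m / sigma) * (0 : R).
  apply: cvgMl_tmp; apply: (gtr0_cvgV0 (f := id) _).2; last exact: cvg_id.
  exact: nbhs_pinfty_gt.
rewrite mulr0 in lim0.
apply: squeeze_cvgr (cvg_cst 0) lim0.
near=> t; have t0 : 0 < t by near: t; exact: nbhs_pinfty_gt.
have e0 : 0 < expR (- (sigma * t)) := expR_gt0 _.
have e1 : expR (- (sigma * t)) <= 1.
  by rewrite -expR0 ler_expR oppr_le0 mulr_ge0// ltW.
have -> : bias sigma pi phi x t =
    (1 - expR (- (sigma * t))) * (L * m / sigma * t^-1).
  by rewrite /bias -/L -/m; field; rewrite !gt_eqF.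
have p0 : 0 <= L * m / sigma * t^-1.
  by rewrite !mulr_ge0// invr_ge0 ltW.
by rewrite mulr_ge0 ?subr_ge0//= ler_piMl// lerBlDr lerDl ltW.
Unshelve. all: by end_near. Qed.

Theorem theorem2p6 (R : realType) (dE dO : measure_display)
    (E : measurableMetricType R dE) (Omega : measurableType dO)
    (F : R -> set (set Omega)) (P : E -> probability Omega R)
    (X : R -> {mfun Omega >-> E}) (Q : R.-ker E ~> E)
    (sigma b V : R) (pi : probability E R) (phi : E -> R)
    (polishE : polish E)
    (borelE : borel_sigma_algebra E)
    (jumpX : cadlag_markov_jump_process P X F Q)
    (momentX : forall t x, 0 < t -> finite_first_moment (transition P X t x))
    (curvature : is_wasserstein_curvature P X sigma)
    (sigma_gt0 : 0 < sigma) (b_gt0 : 0 < b) (V_gt0 : 0 < V)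
    (jump_le : forall x, {ae P x, forall w, forall t, 0 < t ->
      mdist (left_lim (X ^~ w) t) (X t w) <= b})
    (variance_le :
      (ereal_sup [set \int[Q x]_y ((mdist x y) ^+ 2)%:E | x in [set: E]]
       <= (V ^+ 2)%:E)%E)
    (momentpi : finite_first_moment pi)
    (stationarypi : stationary P X pi)
    (Lipphi : Lip phi) :
  (forall x t y, 0 < t -> 0 < y ->
    (P x [set w | (y + bias sigma pi phi x t <=
            `| t^-1 * (\int[lebesgue_measure]_(s in `[0, t]) phi (X s w))
               - \int[pi]_z phi z |)%R]
     <= (deviation_bound sigma b V phi t y)%:E)%E) /\
  (forall x, bias sigma pi phi x t @[t --> +oo] --> (0 : R)).
Proof.
split=> [x t y t0 y0|x]; last exact: bias_cvg0.
have phiL := lipc_lip_norm Lipphi.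
have Lfin : lip_norm phi \is a fin_num by rewrite ge0_fin_numE ?lip_norm_ge0.
rewrite /deviation_bound; case: ifPn => [/eqP L0|L_neq0].
  have constphi z z' : phi z = phi z'.
    apply/eqP; rewrite -subr_eq0 -normr_le0.
    by have := phiL z z'; rewrite L0 mul0r.
  rewrite (_ : [set w | _] = set0) ?measure0//; apply/seteqP; split=> // w /=.
  rewrite /bias L0/= mulr0 !mul0r addr0.
  have -> : \int[pi]_z phi z = phi x.
    under eq_Rintegral do rewrite (constphi _ x).
    by rewrite Rintegral_cst// [X in fine X]probability_setT mulr1.
  under eq_Rintegral do rewrite (constphi _ x).
  rewrite Rintegral_cst//= lebesgue_measure_itv/= lte_fin t0 -EFinB/= subr0.
  by rewrite mulrC mulfK ?gt_eqF// subrr normr0 leNgt y0.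
set L := fine (lip_norm phi).
have L_gt0 : 0 < L.
  rewrite lt_def fine_ge0 ?lip_norm_ge0// andbT.
  by apply: contra L_neq0 => /eqP L0; rewrite -(fineK Lfin) -/L L0.
have jumps : forall w, jump_path (X ^~ w) by have [] := jumpX.
have e1 : 0 < 1 - expR (- (sigma * t)).
  by rewrite subr_gt0 -expR0 ltr_expR oppr_lt0 mulr_gt0.
pose c := (1 - expR (- (sigma * t))) * L / sigma.
pose m := \int[pi]_z mdist x z.
pose dev (f : E -> R) := [set w | t * y + c * m <=
  time_integral X f t w - t * \int[pi]_z f z].
have mphi := lipc_measurable borelE phiL.
have mdev f : lipc L f -> measurable (dev f).
  move=> fL; rewrite -[dev f]setTI; apply: measurable_fun_le => //.
  apply: measurable_funB => //; apply: measurable_time_integral => //.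
  exact: (lipc_measurable borelE fL).
have tail f : lipc L f -> (P x (dev f) <=
    (expR (- (V ^+ 2 * t / b ^+ 2 * g (b * y / (V ^+ 2 * c)))))%:E)%E.
  move=> fL; exact: (upper_tail borelE jumpX curvature sigma_gt0 b_gt0 V_gt0
    jump_le variance_le momentpi stationarypi (ltW L_gt0) t0 x fL L_gt0 y0).
have NphiL : lipc L (\- phi) by exact: lipcN.
have piN : \int[pi]_z (\- phi) z = - \int[pi]_z phi z.
  have intphi := lipc_integrable borelE momentpi phiL.
  rewrite -mulN1r -RintegralZl//; apply: eq_Rintegral => z _.
  by rewrite mulN1r.
have -> : [set w | y + bias sigma pi phi x t <=
    `|t^-1 * \int[lebesgue_measure]_(s in `[0, t]) phi (X s w) -
      \int[pi]_z phi z|] = dev phi `|` dev (\- phi).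
  have tE w : `|t^-1 * time_integral X phi t w - \int[pi]_z phi z| =
      t^-1 * `|time_integral X phi t w - t * \int[pi]_z phi z|.
    rewrite -[in RHS](gtr0_norm (x := t^-1)) ?invr_gt0// -normrM mulrBr.
    by rewrite mulKf ?gt_eqF.
  have bE : t * (y + bias sigma pi phi x t) = t * y + c * m.
    by rewrite /bias /c -/L -/m; field; rewrite !gt_eqF.
  have devE w : (y + bias sigma pi phi x t <=
      `|t^-1 * time_integral X phi t w - \int[pi]_z phi z|) =
      (t * y + c * m <= time_integral X phi t w - t * \int[pi]_z phi z) ||
      (t * y + c * m <= time_integral X (\- phi) t w - t * \int[pi]_z (\- phi) z).
    rewrite tE ler_pdivlMl// bE ler_normr time_integralN// piN.
    by rewrite mulrN opprB opprK [- _ + _]addrC.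
  apply/seteqP; split=> w /=; first by rewrite devE => /orP[]; [left|right].
  by rewrite devE => -[?|?]; apply/orP; [left|right].
apply: (@le_trans _ _ (P x (dev phi) + P x (dev (\- phi)%R))%E).
  by apply: measureU2; exact: mdev.
rewrite [2]mulr2n mulrDl mul1r EFinD.
have -> : b * y * sigma / (V ^+ 2 * (1 - expR (- (sigma * t))) * L) =
    b * y / (V ^+ 2 * c).
  by rewrite /c; field; rewrite !gt_eqF.
by apply: leeD; exact: tail.
Qed.
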